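(* Let $(G,\sigma)$ be a 2-edge-connected signed graph with at least one edge and with even negativeness $\epsilon(G,\sigma)$. Then $(G,\sigma)$ has a signed-circuit cover $\mathcal C$ whose length satisfies $\ell(\mathcal C)<\frac{8}{3}|E(G)|$.
   Context: Graphs are finite and may have multiple edges and loops (a loop is an edge). A graph is 2-edge-connected if it is connected and has no bridge. A cycle is a connected 2-regular graph (a loop is a cycle of length 1, two parallel edges form a cycle of length 2). A signed graph $(G,\sigma)$ is a graph $G$ with a mapping $\sigma:E(G)\to\{-1,+1\}$; an edge $e$ is negative if $\sigma(e)=-1$ and positive otherwise. A cycle is positive if it contains an even number of negative edges, and negative otherwise. A short barbell is the union of two negative cycles $C_1,C_2$ such that $C_1\cap C_2$ is a single vertex; a long barbell consists of two vertex-disjoint negative cycles $C_1,C_2$ together with a minimal path $P$ joining them (so $P$ meets $C_1\cup C_2$ only in its two endvertices, one on each cycle). A barbell is a short or a long barbell. A signed-circuit is a positive cycle or a barbell. A signed-circuit cover of $(G,\sigma)$ is a family $\mathcal C$ (repetitions allowed) of signed-circuits such that every edge of $G$ belongs to at least one member; its length is $\ell(\mathcal C)=\sum_{C\in\mathcal C}|E(C)|$. Two signatures $\sigma,\sigma'$ of $G$ are equivalent if one is obtained from the other by switching on an edge cut, i.e. there is a set $X\subseteq V(G)$ such that $\sigma'(e)=-\sigma(e)$ for every edge $e$ with exactly one end in $X$ and $\sigma'(e)=\sigma(e)$ for all other edges. The negativeness $\epsilon(G,\sigma)$ is the smallest number of negative edges over all signatures equivalent to $\sigma$. *)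

(* Defs.v *)
From mathcomp Require Import all_boot all_order all_algebra.

Set Implicit Arguments.
Unset Strict Implicit.
Unset Printing Implicit Defensive.

(* Finite multigraphs: parallel edges and loops are allowed.  The order of the
   pair [ends e] carries no meaning; every notion below is symmetric in it. *)
Record multigraph := Multigraph {
  vertex : finType;
  edge : finType;
  ends : edge -> vertex * vertex
}.

Section Multigraph.
Variable G : multigraph.
Implicit Types (e : edge G) (x y v : vertex G) (W X : {set vertex G}).
Implicit Types (F C : {set edge G}) (p : seq (edge G * vertex G)).

Definition joins e x y : bool := (ends e == (x, y)) || (ends e == (y, x)).

Definition adj F : rel (vertex G) := [rel x y | [exists e in F, joins e x y]].

(* Subgraphs without isolated vertices (cycles, nontrivial paths, barbells) are
   represented by their edge sets; [cov F] is the corresponding vertex set. *)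
Definition cov F : {set vertex G} :=
  [set v | [exists e in F, (v == (ends e).1) || (v == (ends e).2)]].

(* A loop contributes 2 to the degree of its end. *)
Definition degree F v : nat :=
  \sum_(e in F) (((ends e).1 == v) + ((ends e).2 == v)).

Definition connected_sub W F : bool :=
  (W != set0) && [forall x in W, forall y in W, connect (adj F) x y].

Definition connected_graph : bool := connected_sub setT setT.

Definition bridge e : bool :=
  n_comp (adj setT) (vertex G) < n_comp (adj [set~ e]) (vertex G).

Definition two_edge_connected : bool :=
  connected_graph && [forall e, ~~ bridge e].

Definition is_cycle C : bool :=
  connected_sub (cov C) C && [forall v in cov C, degree C v == 2].

(* [is_path x p]: starting at [x], the list [p] of pairs (edge, next vertex)
   describes a path, i.e. a walk without repeated vertices. *)
Fixpoint is_walk x p : bool :=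
  if p is (e, y) :: p' then joins e x y && is_walk y p' else true.

Definition path_vertices x p : seq (vertex G) := x :: [seq ey.2 | ey <- p].
Definition path_end x p : vertex G := last x [seq ey.2 | ey <- p].
Definition path_edges p : {set edge G} := [set e in [seq ey.1 | ey <- p]].

Definition is_path x p : bool := is_walk x p && uniq (path_vertices x p).

(* A signature is encoded by its set of negative edges, as a boolean function:
   the sign of [e] is (-1) ^+ sigma e, so that [true] means negative. *)
Definition signature := {ffun edge G -> bool}.
Implicit Types sigma tau : signature.

Definition neg_edges sigma : {set edge G} := [set e | sigma e].

Definition positive_cycle sigma C : bool :=
  is_cycle C && ~~ odd #|C :&: neg_edges sigma|.
Definition negative_cycle sigma C : bool :=
  is_cycle C && odd #|C :&: neg_edges sigma|.

(* The intersection being a single vertex also excludes common edges (this is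
   not implied by the condition on vertices when a cycle is a loop). *)
Definition short_barbell sigma F : Prop :=
  exists C1 C2 : {set edge G},
    [/\ negative_cycle sigma C1, negative_cycle sigma C2,
        #|cov C1 :&: cov C2| = 1, C1 :&: C2 = set0
      & F = C1 :|: C2].

Definition long_barbell sigma F : Prop :=
  exists (C1 C2 : {set edge G}) (x : vertex G) (p : seq (edge G * vertex G)),
    [/\ negative_cycle sigma C1 /\ negative_cycle sigma C2,
        cov C1 :&: cov C2 = set0,
        is_path x p,
        [set v in path_vertices x p] :&: cov C1 = [set x] /\
        [set v in path_vertices x p] :&: cov C2 = [set path_end x p]
      & F = C1 :|: C2 :|: path_edges p].

Definition barbell sigma F : Prop :=
  short_barbell sigma F \/ long_barbell sigma F.

Definition signed_circuit sigma F : Prop :=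
  positive_cycle sigma F \/ barbell sigma F.

Definition signed_circuit_cover sigma (CC : seq {set edge G}) : Prop :=
  (forall F, F \in CC -> signed_circuit sigma F) /\
  (forall e, exists2 F, F \in CC & e \in F).

Definition cover_length (CC : seq {set edge G}) : nat := \sum_(F <- CC) #|F|.

Definition in_cut X e : bool := ((ends e).1 \in X) (+) ((ends e).2 \in X).

Definition sig_equiv sigma tau : bool :=
  [exists X : {set vertex G}, forall e,
     tau e == (if in_cut X e then ~~ sigma e else sigma e)].

Definition negativeness sigma : nat :=
  #|neg_edges [arg min_(tau < sigma | sig_equiv sigma tau) #|neg_edges tau|]|.

Lemma sig_equiv_refl sigma : sig_equiv sigma sigma.
Proof. by apply/existsP; exists set0; apply/forallP => e; rewrite /in_cut !inE. Qed.

Lemma negativenessP sigma :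
  (exists2 tau, sig_equiv sigma tau & negativeness sigma = #|neg_edges tau|) /\
  (forall tau, sig_equiv sigma tau -> negativeness sigma <= #|neg_edges tau|).
Proof.
rewrite /negativeness; case: arg_minnP => [|tau tauP tau_min].
  exact: sig_equiv_refl.
by split; first by exists tau.
Qed.

End Multigraph.

(* Main.v *)
(**
Let N be the set of negative edges of a minimal equivalent signature, B the set
of bridges of G - N, and A the set of the other edges, a bridgeless all-positive
graph, which has a cycle cover of length at most 5|A|/3.  Since every cut has at
most as many edges in N as outside, G - N is connected and each b in B is in a
cut consisting of b and one edge of N.  Hence some even set H contains N, and
then also B; averaging over translates by even subsets of A gives
|H \cap A| <= |A|/2.  Split H into positive cycles and negative cycles pairwise
sharing at most one vertex; the latter are evenly many.  Choose a vertex on each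
and a set Q, |Q| <= |E|/2, of odd degree exactly where an odd number of them was
chosen: Q contains edge-disjoint paths pairing the negative cycles into
barbells.  The total length is at most 5|A|/3 + |H| + |Q|
<= 8|A|/3 + 3|N \cup B|/2.

The 5/3 bound for a bridgeless graph comes from Seymour's 6-flow theorem, an even
set C with a Z/3-flow that is nonzero outside C.  Each Z/3-flow g gives even sets
D1, D2, D3 = D1 + D2 such that every edge of its support is in exactly two of
them; averaging over the covers {C, Di, Dj}, {Di, Dj, C + Dk} and over three
choices of g gives 5/3.
*)
Require Import Defs.
From mathcomp Require Import all_boot all_order all_algebra.
From mathcomp Require Import zify.

Set Implicit Arguments.
Unset Strict Implicit.
Unset Printing Implicit Defensive.

Import Order.TTheory GRing.Theory Num.Theory.

(** An edge of B lies on no cycle of G - N, so a cycle cover of the positive part cannot reach it;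
    this is why the even set H has to carry N and B together. The constant splits as 8/3 = 5/3 + 1/2
    + 1/2, for the cover of A, for H inside A and for the join Q. Edges of N and B are paid for by H
    and Q alone, at rate 3/2, and this gap makes the inequality strict as soon as one such edge
    exists. Evenness of the negativeness enters through |H \cap N| = |N|. Parities are treated as
    flows over Z/2. A single integrality statement, 0-1 flows under a cut condition, serves three
    purposes: it lifts a Z/3-flow to integers, it turns an even set into a +-1 flow, and it yields
    two edge-disjoint paths in Seymour's growth argument. *)

Section Flows.
Local Open Scope ring_scope.

(** * Divergence and 0-1 flows *)

Section Divergence.
Variable G : multigraph.
Implicit Types (e : edge G) (v : vertex G) (S X W : {set vertex G}).
Implicit Types (F C D Y : {set edge G}).

Definition src e := (ends e).1.
Definition tgt e := (ends e).2.

(* Z/2 is represented by bool, whose addition is (+): see [odd_degree]. *)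
Definition divg (M : zmodType) (f : edge G -> M) v : M :=
  \sum_e (f e *+ (src e == v) - f e *+ (tgt e == v)).

Lemma sum_mulrn_eq (M : zmodType) (x : M) (w : vertex G) S :
  \sum_(v in S) x *+ (w == v) = x *+ (w \in S).
Proof.
case: (boolP (w \in S)) => wS; last first.
  by apply: big1 => v vS; case: eqP => // E; rewrite E vS in wS.
rewrite (bigD1 w) //= eqxx big1 ?addr0 // => v /andP[_ /negPf].
by rewrite eq_sym => ->.
Qed.

Lemma sum_divg (M : zmodType) (f : edge G -> M) S :
  \sum_(v in S) divg f v
    = \sum_e (f e *+ (src e \in S) - f e *+ (tgt e \in S)).
Proof.
rewrite /divg exchange_big; apply: eq_bigr => e _ /=.
by rewrite sumrB !sum_mulrn_eq.
Qed.

Lemma sum_divgT (M : zmodType) (f : edge G -> M) : \sum_v divg f v = 0.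
Proof.
have := sum_divg f setT; rewrite (eq_bigl xpredT) => [->|v]; last by rewrite inE.
by apply: big1 => e _; rewrite !inE subrr.
Qed.

Lemma eq_divg (M : zmodType) (f g : edge G -> M) : f =1 g -> divg f =1 divg g.
Proof. by move=> fg v; apply: eq_bigr => e _; rewrite fg. Qed.

Lemma divgD (M : zmodType) (f g : edge G -> M) v :
  divg (fun e => f e + g e) v = divg f v + divg g v.
Proof.
by rewrite -big_split; apply: eq_bigr => e _; rewrite !mulrnDl opprD addrACA.
Qed.

Lemma divgN (M : zmodType) (f : edge G -> M) v :
  divg (fun e => - f e) v = - divg f v.
Proof. by rewrite -sumrN; apply: eq_bigr => e _; rewrite !mulNrn opprD. Qed.

Lemma divgB (M : zmodType) (f g : edge G -> M) v :
  divg (fun e => f e - g e) v = divg f v - divg g v.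
Proof. by rewrite divgD divgN. Qed.

Lemma divg0 (M : zmodType) v : divg (fun=> 0 : M) v = 0.
Proof. by apply: big1 => e _; rewrite !mul0rn subrr. Qed.

Lemma divg_additive (M M' : zmodType) (phi : {additive M -> M'}) f v :
  divg (fun e => phi (f e)) v = phi (divg f v).
Proof.
by rewrite raddf_sum; apply: eq_bigr => e _; rewrite raddfB !raddfMn.
Qed.

Lemma divg_single (M : zmodType) e (x : M) v :
  divg (fun e' => x *+ (e' == e)) v = x *+ (src e == v) - x *+ (tgt e == v).
Proof.
rewrite /divg (bigD1 e) //= eqxx big1 ?addr0 // => e' /negPf->.
by rewrite !mul0rn subrr.
Qed.

Lemma divg_loops (M : zmodType) (f : edge G -> M) v :
  (forall e, src e != tgt e -> f e = 0) -> divg f v = 0.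
Proof.
move=> f0; apply: big1 => e _; case: (eqVneq (src e) (tgt e)) => [->|/f0->].
  by rewrite subrr.
by rewrite !mul0rn subrr.
Qed.

Definition ind (Z : pzRingType) F e : Z := (e \in F)%:R.

Definition outdeg F S : nat := #|[set e in F | (src e \in S) && (tgt e \notin S)]|.

Lemma outdegE F S :
  (outdeg F S)%:Z = \sum_(e in F) ((src e \in S) && (tgt e \notin S))%:R.
Proof.
rewrite /outdeg -sum1_card -natz natr_sum.
rewrite (eq_bigl (fun e => (e \in F) && ((src e \in S) && (tgt e \notin S)))).
  by rewrite big_mkcondr; apply: eq_bigr => e _; case: ifP.
by move=> e; rewrite inE.
Qed.

Lemma sum_divg_ind F S :
  \sum_(v in S) divg (ind int F) v
    = \sum_(e in F) ((src e \in S)%:R - (tgt e \in S)%:R).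
Proof.
rewrite sum_divg big_mkcond [RHS]big_mkcond; apply: eq_bigr => e _.
by rewrite /ind; case: (e \in F); rewrite ?mul0rn ?subrr.
Qed.

Lemma sum_divg_ind_le F S : \sum_(v in S) divg (ind int F) v <= outdeg F S.
Proof.
rewrite sum_divg_ind outdegE; apply: ler_sum => e _.
by case: (src e \in S); case: (tgt e \in S).
Qed.

Lemma outdegU1 F e S : e \in F ->
  (outdeg F S)%:Z
    = ((src e \in S) && (tgt e \notin S))%:R + (outdeg (F :\ e) S)%:Z.
Proof. by move=> eF; rewrite !outdegE (big_setD1 e). Qed.

Lemma outdeg_submod F S X :
  (outdeg F (S :&: X) + outdeg F (S :|: X) <= outdeg F S + outdeg F X)%N.
Proof.
rewrite -lez_nat !PoszD !outdegE -!big_split; apply: ler_sum => e _ /=.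
rewrite !inE.
by case: (src e \in S); case: (src e \in X); case: (tgt e \in S);
   case: (tgt e \in X).
Qed.

(* Hoffman's circulation theorem for capacities 0 and 1: if neither deleting
   nor forcing e keeps the cut condition, two tight sets cross along e, against
   submodularity. *)
Lemma zero_one_flow F (b : vertex G -> int) :
  \sum_v b v = 0 -> (forall S, \sum_(v in S) b v <= outdeg F S) ->
  exists2 Y : {set edge G}, Y \subset F & forall v, divg (ind int Y) v = b v.
Proof.
have [n] := ubnP #|F|; elim: n F b => // n IHn F b leFn sum_b cut_b.
case: (set_0Vmem F) => [F0|[e eF]].
  exists set0; first exact: sub0set.
  have b_le0 S : \sum_(v in S) b v <= 0.
    have := cut_b S; rewrite outdegE F0 big_set0; exact.
  have b_le v : b v <= 0 by have := b_le0 [set v]; rewrite big_set1.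
  move=> v; rewrite (_ : divg _ v = 0).
    have := b_le0 [set~ v]; rewrite (_ : \sum_(w in _) b w = - b v).
      have := b_le v; lia.
    move: sum_b; rewrite (bigD1 v) //= => /eqP; rewrite addrC addr_eq0 => /eqP<-.
    by apply: eq_bigl => w; rewrite !inE.
  by apply: big1 => e _; rewrite /ind inE !mul0rn subrr.
have leF'n : (#|F :\ e| < n)%N by move: leFn; rewrite (cardsD1 e F) eF.
pose b' v : int := b v - ((src e == v)%:R - (tgt e == v)%:R).
have sum_b' S : \sum_(v in S) b' v
    = \sum_(v in S) b v - ((src e \in S)%:R - (tgt e \in S)%:R).
  by rewrite /b' sumrB sumrB !sum_mulrn_eq.
case: (boolP [forall S : {set vertex G},
                \sum_(v in S) b v <= (outdeg (F :\ e) S)%:Z]) => [/forallP ok|].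
  have [Y sY divY] := IHn _ b leF'n sum_b ok.
  by exists Y => //; apply: subset_trans sY (subD1set _ _).
move=> /forallPn[S1]; rewrite -ltNge => bad1.
case: (boolP [forall S : {set vertex G},
                \sum_(v in S) b' v <= (outdeg (F :\ e) S)%:Z]) => [/forallP ok|].
  have sumT (h : vertex G -> int) : \sum_v h v = \sum_(v in setT) h v.
    by apply: eq_bigl => v; rewrite inE.
  have [|Y sY divY] := IHn _ b' leF'n _ ok.
    by rewrite sumT sum_b' !inE subrr subr0 -sumT.
  have eY : e \notin Y.
    by apply/negP => eY; have := subsetP sY e eY; rewrite !inE eqxx.
  exists (e |: Y).
    by rewrite subUset sub1set eF; apply: subset_trans sY (subD1set _ _).
  move=> v; have divYv := divY v; rewrite /b' in divYv.
  rewrite (_ : b v = divg (ind int Y) v + ((src e == v)%:R - (tgt e == v)%:R)).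
    rewrite -(divg_single e (1 : int)) -divgD; apply: eq_divg => e'.
    rewrite /ind !inE; case: eqP => [->|_]; first by rewrite (negPf eY) add0r.
    by rewrite addr0.
  by rewrite divYv subrK.
move=> /forallPn[S2]; rewrite -ltNge sum_b' => bad2.
have modb : \sum_(v in S1 :&: S2) b v + \sum_(v in S1 :|: S2) b v
    = \sum_(v in S1) b v + \sum_(v in S2) b v.
  rewrite !(big_mkcond (fun v => v \in _)) /= -!big_split; apply: eq_bigr => v _.
  by rewrite /= !inE; case: (v \in S1); case: (v \in S2);
     rewrite ?addr0 ?add0r.
(* The two failures force [e] to leave [S1] and to enter [S2], with both sets tight for [F]. Neither
   the intersection nor the union loses an edge with [e], so submodularity for [F :\ e] fails by at
   least one. *)
have := outdeg_submod (F :\ e) S1 S2; have := modb.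
have := cut_b (S1 :&: S2); have := cut_b (S1 :|: S2).
have := cut_b S1; have := cut_b S2; move: bad1 bad2.
rewrite !(outdegU1 _ eF) !inE.
case: (src e \in S1); case: (src e \in S2); case: (tgt e \in S1);
  case: (tgt e \in S2) => /=; lia.
Qed.

(* ind F / k is a fractional solution of the flow problem. *)
Lemma equitable_subset F (k : nat) :
  (0 < k)%N -> (forall v, (k%:Z %| divg (ind int F) v)%Z) ->
  exists2 Y : {set edge G}, Y \subset F &
    forall v, divg (ind int F) v = k%:Z * divg (ind int Y) v.
Proof.
move=> k0 kF; pose b v := (divg (ind int F) v %/ k%:Z)%Z.
have bK v : divg (ind int F) v = k%:Z * b v by rewrite mulrC divzK.
have sbK S : \sum_(v in S) divg (ind int F) v = k%:Z * \sum_(v in S) b v.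
  by rewrite mulr_sumr; apply: eq_bigr.
have kN0 : k%:Z != 0 by lia.
have [||Y sY divY] := @zero_one_flow F b; last first.
- by exists Y => // v; rewrite divY.
- move=> S; have := sum_divg_ind_le F S; rewrite sbK; nia.
apply: (mulfI kN0); rewrite mulr0 mulr_sumr; under eq_bigr do rewrite -bK.
exact: sum_divgT.
Qed.

End Divergence.

Lemma odd_natr (n : nat) : n%:R = odd n :> bool.
Proof. by elim: n => //= n IHn; rewrite mulrS IHn; case: (odd n). Qed.

Lemma odd_intr (z : int) : z%:~R = odd `|z| :> bool.
Proof.
by case: z => n; rewrite ?NegzE ?mulrNz -pmulrn odd_natr //; case: (odd _).
Qed.

Lemma Z3_intr_eq0 (z : int) : (z%:~R == 0 :> 'Z_3) = (3%:Z %| z)%Z.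
Proof.
have := modz_ge0 z (isT : 3%:Z != 0); have := @ltz_pmod z 3 isT.
rewrite {3}(divz_eq z 3) intrD intrM (_ : 3%:~R = 0 :> 'Z_3); last exact/val_inj.
rewrite mulr0 add0r => lt3 ge0; rewrite (_ : (3 %| z)%Z = ((z %% 3)%Z == 0)).
  by case: (z %% 3)%Z lt3 ge0 => [[|[|[|n]]]|n].
by apply/dvdz_mod0P/eqP.
Qed.

Lemma Z3_cases (x : 'Z_3) : [\/ x = 0, x = 1 | x = - 1].
Proof.
case: x => [[|[|[|//]]] lt3]; [apply: Or31 | apply: Or32 | apply: Or33];
  exact: val_inj.
Qed.

(** * Even edge sets as flows over Z/2 *)

Section EvenSets.
Variable G : multigraph.
Implicit Types (e : edge G) (v : vertex G) (S X W : {set vertex G}).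
Implicit Types (F C D Y : {set edge G}).

Definition even_set F := forall v, ~~ odd (degree F v).

Lemma odd_degree F v : odd (degree F v) = divg (ind bool F) v.
Proof.
rewrite /degree -odd_natr natr_sum big_mkcond; apply: eq_bigr => e _.
by rewrite /ind natrD /src /tgt; case: (e \in F); rewrite ?mul0rn ?subrr.
Qed.

Lemma even_setP F : even_set F <-> divg (ind bool F) =1 (fun=> 0).
Proof.
split=> evF v; last by rewrite odd_degree evF.
by have := evF v; rewrite odd_degree; apply: negPf.
Qed.

Lemma even_flow (c : edge G -> bool) :
  divg c =1 (fun=> 0) -> even_set [set e | c e].
Proof.
move=> c0; apply/even_setP => v; rewrite -(c0 v); apply: eq_divg => e.
by rewrite /ind inE; case: (c e).
Qed.

Lemma even_set0 : even_set set0.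
Proof. by move=> v; rewrite /degree big_set0. Qed.

Definition symdiff F C := (F :\: C) :|: (C :\: F).

Lemma in_symdiff F C e : (e \in symdiff F C) = (e \in F) (+) (e \in C).
Proof. by rewrite !inE; case: (e \in F); case: (e \in C). Qed.

Lemma odd_degree_symdiff F C v :
  odd (degree (symdiff F C) v) = odd (degree F v) (+) odd (degree C v).
Proof.
rewrite !odd_degree -[RHS]divgD; apply: eq_divg => e; rewrite /ind in_symdiff.
by case: (e \in F); case: (e \in C).
Qed.

Lemma even_symdiff F C : even_set F -> even_set C -> even_set (symdiff F C).
Proof.
by move=> evF evC v; rewrite odd_degree_symdiff (negPf (evF v)) (negPf (evC v)).
Qed.

Lemma even_int (k : edge G -> int) :
  (forall v, (2 %| divg k v)%Z) -> even_set [set e | odd `|k e|].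
Proof.
move=> k2; apply: even_flow => v.
transitivity (divg (fun e => (k e)%:~R : bool) v).
  by apply: eq_divg => e; rewrite odd_intr.
rewrite (divg_additive (intmul 1)) /= odd_intr.
by have /dvdzP[q ->] := k2 v; rewrite abszM oddM andbF.
Qed.

Lemma even_int_ind F : (forall v, (2 %| divg (ind int F) v)%Z) -> even_set F.
Proof.
move=> /even_int; congr even_set; apply/setP => e.
by rewrite inE /ind; case: (e \in F).
Qed.

Lemma even_double_int (F Y : {set edge G}) :
  (forall v, divg (ind int F) v = 2%:Z * divg (ind int Y) v) -> even_set F.
Proof.
by move=> FY; apply: even_int_ind => v; rewrite FY; apply: dvdz_mulr.
Qed.

End EvenSets.

(* Orient the support so that g = 1 and lift to an integer flow with values 1 and
   -2 (k = 3); the odd values form one even set, and a +-1 flow on it (k = 2)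
   gives an even set containing the other edges. *)
Lemma flow3_cover (G : multigraph) (g : edge G -> 'Z_3) :
  divg g =1 (fun=> 0) ->
  exists D1 D2 : {set edge G}, [/\ even_set D1, even_set D2 &
    forall e, (e \in D1) || (e \in D2) = (g e != 0)].
Proof.
move=> g0.
pose G' := @Multigraph (vertex G) (edge G)
             (fun e => if g e == 1 then ends e else (tgt e, src e)).
have evG' (F : {set edge G}) : @even_set G' F -> even_set F.
  move=> evF v; have := evF v; congr (~~ odd _); apply: eq_bigr => e _ /=.
  by rewrite /src /tgt; case: (g e == 1) => //; apply: addnC.
pose F : {set edge G'} := [set e | g e != 0].
have [|Y sYF FY] := @equitable_subset G' F 3 isT.
  move=> v; rewrite -Z3_intr_eq0 -[_%:~R](divg_additive (intmul (1 : 'Z_3))).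
  apply/eqP; rewrite -[RHS](g0 v); apply: eq_bigr => e _.
  rewrite /ind inE /src /tgt /=.
  case: (Z3_cases (g e)) => ->; rewrite ?eqxx ?oner_eq0 /=.
  - by rewrite !mulr0z !mul0rn.
  - by rewrite mulr1z.
  - by rewrite mulr1z !mulNrn opprK addrC.
(* The integer lift is 1 on [O] and -2 on [Y], that is, [F] minus three times [Y]. Its divergence
   vanishes, so that of [O] is twice that of [Y]. *)
pose O : {set edge G'} := F :\: Y.
have divO v : divg (ind int O) v = 2 * divg (ind int Y) v.
  transitivity (divg (fun e => ind int F e - ind int Y e) v).
    apply: eq_divg => e; rewrite /ind /O in_setD.
    by have := subsetP sYF e; case: (e \in Y) => [->|_] //=; rewrite subr0.
  by rewrite divgB FY -[X in _ - X]mul1r -mulrBl.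
have [|Z sZO OZ] := @equitable_subset G' O 2 isT.
  by move=> v; rewrite divO; apply: dvdz_mulr.
have YZ v : divg (ind int Y) v = divg (ind int Z) v by have := divO v; rewrite OZ; lia.
(* [Y] and [Z] are disjoint with equal divergences, so their union has even ones; it contains the
   part of the support outside [O]. *)
exists O, (Y :|: Z); split.
- exact/evG'/even_double_int/divO.
- apply/evG'/even_double_int => v.
  transitivity (divg (fun e => ind int Y e + ind int Z e) v); last first.
    rewrite divgD -YZ -mulr2n -mulr_natl; reflexivity.
  apply: eq_divg => e; rewrite /ind in_setU.
  have := subsetP sZO e; rewrite in_setD.
  by case: (e \in Z); case: (e \in Y) => // /(_ isT).
- move=> e; have := subsetP sYF e; have := subsetP sZO e.
  rewrite in_setU /O in_setD /F in_set.
  case: (e \in Y); case: (e \in Z); case: (g e != 0) => //=;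
    by [move=> /(_ isT) | move=> _ /(_ isT)].
Qed.

(** * Connectivity, edge-disjoint paths and prescribed divergences *)

Section Connectivity.
Variable G : multigraph.
Implicit Types (e : edge G) (v x y u w : vertex G) (S X W L : {set vertex G}).
Implicit Types (F C D Y : {set edge G}).

Lemma joins_endsP e x y :
  reflect ((src e = x /\ tgt e = y) \/ (src e = y /\ tgt e = x)) (joins e x y).
Proof.
rewrite /joins /src /tgt; case: (ends e) => a b /=; rewrite !xpair_eqE.
apply: (iffP orP) => [[/andP[/eqP-> /eqP->]|/andP[/eqP-> /eqP->]]|[[-> ->]|[-> ->]]].
- by left.
- by right.
- by rewrite !eqxx; left.
- by rewrite !eqxx; right.
Qed.

Lemma joins_ends e : joins e (src e) (tgt e).
Proof. by apply/joins_endsP; left. Qed.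

Lemma joins_sym e x y : joins e x y = joins e y x.
Proof. by rewrite /joins orbC. Qed.

Lemma adjP F x y : reflect (exists2 e, e \in F & joins e x y) (adj F x y).
Proof. by apply: (iffP exists_inP). Qed.

Lemma adj_connect_sym F : connect_sym (adj F).
Proof.
apply: sym_connect_sym => x y.
by apply/adjP/adjP => -[e eF]; rewrite joins_sym; exists e.
Qed.

Lemma connect_end F x e :
  e \in F -> connect (adj F) x (src e) = connect (adj F) x (tgt e).
Proof.
move=> eF; apply: (same_connect_r (@adj_connect_sym F)); apply: connect1.
by apply/adjP; exists e; rewrite ?joins_ends.
Qed.

Lemma sub_connect_adj F C x y :
  F \subset C -> connect (adj F) x y -> connect (adj C) x y.
Proof.
move=> sFC; apply: connect_sub => a b /adjP[e eF ab]; apply: connect1.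
by apply/adjP; exists e; rewrite ?(subsetP sFC).
Qed.

Definition inner X := [set e | (src e \in X) && (tgt e \in X)].

Definition between X W :=
  [set e | (src e \in X) && (tgt e \in W) || (src e \in W) && (tgt e \in X)].

Lemma in_cutE S e : in_cut S e = (src e \in S) (+) (tgt e \in S).
Proof. by []. Qed.

(* Two edge-disjoint paths from u to v are a flow of value 2 in the digraph with
   both orientations of each edge; the edges carrying nonzero net flow work. *)
Lemma connected_even_subset L u v :
  u \in L -> v \in L ->
  (forall S, S \subset L -> u \in S -> v \notin S ->
     (1 < #|between S (L :\: S)|)%N) ->
  exists D : {set edge G},
    [/\ D \subset inner L, even_set D & connect (adj D) u v].
Proof.
move=> uL vL cutL; case: (eqVneq u v) => [<-|uv].
  by exists set0; split; [exact: sub0set | exact: even_set0 | exact: connect0].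
pose G2 := @Multigraph (vertex G) (edge G * bool)%type
  (fun d => if d.2 then ends d.1 else (tgt d.1, src d.1)).
pose F2 : {set edge G2} := [set d | d.1 \in inner L].
pose b w : int := ((1 *+ (u == w) - 1 *+ (v == w)) *+ 2).
have sumb S : \sum_(w in S) b w = (1 *+ (u \in S) - 1 *+ (v \in S)) *+ 2.
  by rewrite sumrMnl sumrB !sum_mulrn_eq.
have [||Y sY divY] := @zero_one_flow G2 F2 b.
- transitivity (\sum_(w in setT) b w); first by apply: eq_bigl => w; rewrite inE.
  by rewrite sumb !inE subrr mul0rn.
- move=> S; rewrite [X in X <= _]sumb.
  case: (boolP ((u \in S) && (v \notin S))) => [/andP[uS vS]|]; last first.
    by case: (u \in S); case: (v \in S) => //= _; rewrite ?subrr ?mul0rn.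
  rewrite uS (negPf vS) subr0; rewrite -[1 *+ 2]/(2%:Z) lez_nat.
  apply: leq_trans (cutL (S :&: L) _ _ _) _;
    rewrite ?subsetIr ?inE ?uS ?uL ?(negPf vS) //.
  (* Each edge across the cut has exactly one orientation that leaves [S]; [h] selects it. *)
  pose h e : edge G2 := (e, src e \in S).
  rewrite -(@card_imset _ _ h); last by move=> e e' [].
  apply/subset_leq_card/subsetP => _ /imsetP[e + ->].
  have [sS|sS] := boolP (src e \in S);
    rewrite /h ?sS ?(negPf sS) /F2 !inE /src /tgt /= ?sS ?(negPf sS) /=;
    by case: ((ends e).2 \in S) => /=;
       case: ((ends e).1 \in L); case: ((ends e).2 \in L).
pose k e : int := ind int Y (e, true) - ind int Y (e, false).
have divk w : divg k w = b w.
  rewrite -divY [RHS]/divg; apply/esym.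
  rewrite (eq_bigr (fun d : edge G * bool =>
    (fun e d2 => ind int Y (e, d2) *+ ((if d2 then src e else tgt e) == w)
     - ind int Y (e, d2) *+ ((if d2 then tgt e else src e) == w)) d.1 d.2)); last first.
    by case=> e [] _.
  rewrite -(pair_bigA _ (fun e d2 =>
    ind int Y (e, d2) *+ ((if d2 then src e else tgt e) == w)
     - ind int Y (e, d2) *+ ((if d2 then tgt e else src e) == w))) /=.
  apply: eq_bigr => e _; rewrite big_bool /= /k !mulrnBl.
  by rewrite opprB [LHS]addrACA [RHS]addrACA; congr (_ + _); apply: addrC.
have k_small e : ~~ odd `|k e| -> k e = 0.
  by rewrite /k /ind; case: (_ \in Y); case: (_ \in Y).
pose D := [set e | odd `|k e|].
exists D; split.
- apply/subsetP => e; rewrite inE; apply: contraTT => eL.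
  have eY d : (e, d) \notin Y.
    by apply: contraNN eL => /(subsetP sY); rewrite /F2 inE.
  by rewrite /k /ind !(negPf (eY _)).
- apply: even_int => w; rewrite divk /b -mulr_natr; exact: dvdz_mull.
(* No net flow leaves the component of [u], yet its demand would be 2 if it missed [v]. *)
- apply/negPn/negP => uvN; pose S := [set w | connect (adj D) u w].
  have := sum_divg k S; rewrite (eq_bigr b) => [|w _]; last exact: divk.
  rewrite sumb !inE connect0 (negPf uvN) /= big1 // => e _.
  rewrite !inE; case: (boolP (e \in D)) => [eD|].
    by rewrite (connect_end _ eD) subrr.
  by rewrite inE => /k_small->; rewrite !mul0rn subrr.
Qed.

Lemma divg_sum (M : zmodType) (I : finType) (g : I -> edge G -> M) v :
  divg (fun e => \sum_i g i e) v = \sum_i divg (g i) v.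
Proof.
rewrite exchange_big; apply: eq_bigr => e _ /=.
by rewrite sumrB !sumrMnl.
Qed.

(** Divergences are prescribed, values are not: over [bool] this is the existence of T-joins, over
    ['Z_3] it repairs the divergence left by a partial choice of values. *)
Definition solvable (M : zmodType) F X :=
  forall b : vertex G -> M, (forall v, v \notin X -> b v = 0) -> \sum_v b v = 0 ->
  exists g : edge G -> M, (forall e, e \notin F -> g e = 0) /\ divg g =1 b.

Lemma transfer (M : zmodType) F x y (m : M) : connect (adj F) x y ->
  exists g : edge G -> M, (forall e, e \notin F -> g e = 0) /\
    forall v, divg g v = m *+ (x == v) - m *+ (y == v).
Proof.
case/connectP => p; elim: p x => [|z p IHp] x /= => [_ ->|/andP[xz pth yE]].
  by exists (fun=> 0); split=> // v; rewrite divg0 subrr.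
have [g [gF divg_g]] := IHp _ pth yE; have [e eF exz] := adjP _ _ _ xz.
pose c := if src e == x then m else - m.
exists (fun e' => g e' + c *+ (e' == e)); split=> [e' e'F|v].
  rewrite gF // add0r; case: eqP => // e'E; by rewrite e'E eF in e'F.
rewrite divgD divg_single divg_g.
rewrite (_ : c *+ (src e == v) - _ = m *+ (x == v) - m *+ (z == v)).
  by rewrite addrC addrA subrK.
rewrite /c; have [[<- <-]|[-> ->]] := joins_endsP _ _ _ exz; first by rewrite eqxx.
case: eqP => [->|_]; first by rewrite !subrr.
by rewrite !mulNrn opprK addrC.
Qed.

(** Every demand is sent along a path to one vertex [x0], where the total vanishes. *)
Lemma solvable_connect (M : zmodType) F X :
  {in X &, forall x y, connect (adj F) x y} -> solvable M F X.
Proof.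
move=> conX b b0 sumb; case: (set_0Vmem X) => [X0|[x0 x0X]].
  exists (fun=> 0); split=> // v; rewrite divg0 b0 // X0 inE //.
have [v|g gP] := @fin_all_exists _ (fun=> edge G -> M) (fun v g =>
  (forall e, e \notin F -> g e = 0) /\
  forall w, divg g w = b v *+ (v == w) - b v *+ (x0 == w)) _.
  case: (boolP (v \in X)) => vX; first exact/transfer/conX.
  exists (fun=> 0); split=> // w.
  by rewrite divg0 b0 // !mul0rn subrr.
exists (fun e => \sum_v g v e); split=> [e eF|w].
  by apply: big1 => v _; case: (gP v) => ->.
rewrite divg_sum (eq_bigr _ (fun v _ => (gP v).2 w)) sumrB sumrMnl sumb mul0rn subr0.
rewrite (bigD1 w) //= eqxx big1 ?addr0 // => v /negPf->; exact: mulr0n.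
Qed.

End Connectivity.

(** * The 6-flow theorem *)

Section Components.
Variable G : multigraph.
Implicit Types (e : edge G) (v x y u w : vertex G) (S X W L : {set vertex G}).
Implicit Types (F C D Y : {set edge G}).

Definition component F u := [set w | connect (adj F) u w].

Lemma component_end F u e :
  e \in F -> (src e \in component F u) = (tgt e \in component F u).
Proof. by move=> eF; rewrite !inE connect_end. Qed.

Lemma component_inner F u w :
  connect (adj F) u w -> connect (adj (F :&: inner (component F u))) u w.
Proof.
case/connectP => p; elim/last_ind: p w => [|p z IHp] w /= => [_ ->|].
  exact: connect0.
rewrite rcons_path last_rcons => /andP[pth /adjP[e eF ez]] ->.
have con := IHp _ pth erefl; apply: (connect_trans con); apply: connect1.
have lW : last u p \in component F u by rewrite inE; apply/connectP; exists p.
apply/adjP; exists e; rewrite // in_setI eF /inner in_set /=.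
have := component_end u eF.
by have [[E _]|[_ E]] := joins_endsP _ _ _ ez; move: lW; rewrite -E => ->;
  [move=> <- | move=> ->].
Qed.

Lemma component_sub F u L : F \subset inner L -> u \in L -> component F u \subset L.
Proof.
move=> sFL uL; apply/subsetP => w; rewrite inE => /connectP[p + ->].
elim: p u uL => //= z p IHp u uL /andP[/adjP[e eF uz] /IHp]; apply.
have := subsetP sFL e eF; rewrite inE => /andP[sL tL].
by have [[_ <-]|[<- _]] := joins_endsP _ _ _ uz.
Qed.

(** No edge of [F] leaves a component, so each degree is kept entirely or drops to 0. *)
Lemma even_component F u : even_set F -> even_set (F :&: inner (component F u)).
Proof.
move=> evF v; case: (boolP (v \in component F u)) => vW.
  rewrite (_ : degree _ v = degree F v) // /degree [LHS]big_mkcond [RHS]big_mkcond.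
  apply: eq_bigr => e _; rewrite in_setI; case: (boolP (e \in F)) => //= eF.
  rewrite inE; case: ifPn => //; have := component_end u eF; rewrite /src /tgt.
  case: eqP => [->|_]; first by rewrite vW => <-.
  case: eqP => [->|_]; first by rewrite vW => ->.
  by [].
rewrite /degree big1 // => e; rewrite !inE => /andP[_ /andP[sW tW]].
rewrite /src /tgt in sW tW.
have ne z : connect (adj F) u z -> (z == v) = false.
  by move=> uz; apply: contraNF vW => /eqP<-; rewrite inE.
by rewrite !ne.
Qed.

End Components.

Section Growth.
Variable G : multigraph.
Implicit Types (e : edge G) (v x y u w : vertex G) (S X W L : {set vertex G}).
Implicit Types (F C D Y : {set edge G}).

(* Seymour's closure argument in group-connectivity form: arbitrary forbidden
   values p, not just 0, are what makes the property inductive. *)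
Definition tractable X :=
  solvable 'Z_3 (inner X) X /\
  exists C, [/\ C \subset inner X, even_set C &
    forall p : edge G -> 'Z_3, exists g : edge G -> 'Z_3,
      [/\ forall e, e \notin inner X -> g e = 0, divg g =1 (fun=> 0) &
          forall e, e \in inner X -> e \notin C -> g e != p e]].

Lemma tractable1 x : tractable [set x].
Proof.
split.
  by apply: solvable_connect => a b; rewrite !inE => /eqP-> /eqP->; exact: connect0.
exists set0; split; [exact: sub0set | exact: even_set0 |].
move=> p; exists (fun e => if e \in inner [set x] then p e + 1 else 0); split.
- by move=> e /negPf->.
- move=> v; apply: divg_loops => e ne; rewrite !inE.
  by case: ifP => // /andP[/eqP sx /eqP tx]; rewrite sx tx eqxx in ne.
- move=> e -> _; rewrite -subr_eq0 addrAC subrr add0r; exact: oner_neq0.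
Qed.

(** By the equation the second value is an injective function of the first. Two choices remain for
    the first, and at most one of them yields [p2]. *)
Lemma two_values (c p1 p2 : 'Z_3) (s1 s2 : bool) :
  exists x1 x2 : 'Z_3, [/\ x1 != p1, x2 != p2 &
    c + (if s1 then x1 else - x1) + (if s2 then x2 else - x2) = 0].
Proof.
pose t s (x : 'Z_3) := if s : bool then x else - x.
have tK s : involutive (t s) by case: s => x //=; apply: opprK.
pose h a := t s2 (- (c + t s1 a)).
have hP a : c + t s1 a + t s2 (h a) = 0 by rewrite tK subrr.
have h_inj : injective h.
  by move=> x y /(inv_inj (tK s2)) /oppr_inj /addrI /(inv_inj (tK s1)).
case: (eqVneq (h (p1 + 1)) p2) => [E|ne].
  exists (p1 - 1), (h (p1 - 1)); split; last exact: hP.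
    by rewrite -subr_eq0 addrAC subrr add0r.
  by rewrite -E (inj_eq h_inj) (inj_eq (addrI p1)).
exists (p1 + 1), (h (p1 + 1)); split=> //; last exact: hP.
by rewrite -subr_eq0 addrAC subrr add0r.
Qed.

Lemma solvable_disjoint (M : zmodType) F D X W (b : vertex G -> M) :
  [disjoint X & W] -> solvable M F X -> solvable M D W ->
  (forall v, v \notin X :|: W -> b v = 0) ->
  \sum_v b v = 0 -> \sum_(v in W) b v = 0 ->
  exists gX gW : edge G -> M,
    [/\ forall e, e \notin F -> gX e = 0, forall e, e \notin D -> gW e = 0 &
        forall v, divg gX v + divg gW v = b v].
Proof.
move=> dXW solX solW b0 sumb sumW.
pose bW v := if v \in W then b v else 0.
have [||gW [gW0 divW]] := solW bW; first by move=> v; rewrite /bW => /negPf->.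
  by rewrite -big_mkcond.
have [||gX [gX0 divX]] := solX (fun v => b v - bW v).
- move=> v vX; rewrite /bW; case: (boolP (v \in W)) => vW; first by rewrite subrr.
  by rewrite subr0 b0 // inE negb_or vX.
- by rewrite sumrB sumb -big_mkcond sumW subrr.
by exists gX, gW; split=> // v; rewrite divX divW subrK.
Qed.

(* The values on e1 and e2 are chosen last: their sum (up to sign) is prescribed,
   and three values leave room for avoiding one on each. *)
Lemma tractableU X W D e1 e2 :
  tractable X -> [disjoint X & W] -> D \subset inner W -> even_set D ->
  (forall M, solvable M D W) ->
  e1 \in between X W -> e2 \in between X W -> e1 != e2 -> tractable (X :|: W).
Proof.
move=> [solX [C [sCX evC gC]]] dXW sDW evD solD e1XW e2XW e12.
have notX v : v \in W -> v \notin X by move=> vW; rewrite (disjointFl dXW).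
have inXU : inner X \subset inner (X :|: W).
  by apply/subsetP => e; rewrite !inE => /andP[-> ->].
have inWU : inner W \subset inner (X :|: W).
  by apply/subsetP => e; rewrite !inE => /andP[-> ->]; rewrite !orbT.
have btw_end e : e \in between X W -> (tgt e \in W) = ~~ (src e \in W).
  rewrite inE => /orP[] /andP[sE tE].
    by rewrite tE; apply/esym/negP => /notX; rewrite sE.
  by rewrite sE; apply/negP => /notX; rewrite tE.
have btwU e : e \in between X W -> e \in inner (X :|: W).
  by rewrite !inE => /orP[] /andP[-> ->]; rewrite !orbT.
have btwX e : e \in between X W -> e \notin inner X.
  rewrite !inE => /orP[] /andP[eX eW]; apply/negP => /andP[eX' eX''].
    by have := notX _ eW; rewrite eX''.
  by have := notX _ eX; rewrite eX'.
have btwD e : e \in between X W -> e \notin D.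
  move=> exw; apply/negP => /(subsetP sDW); rewrite inE => /andP[sW tW].
  by have := btw_end _ exw; rewrite sW tW.
have sum_single (M : zmodType) e (x : M) : e \in between X W ->
    \sum_(v in W) divg (fun e' => x *+ (e' == e)) v
      = if src e \in W then x else - x.
  move=> exw; rewrite (eq_bigr _ (fun v _ => divg_single e x v)) sumrB.
  rewrite !sum_mulrn_eq (btw_end _ exw).
  by case: (src e \in W); rewrite ?subr0 ?sub0r.
have div_out (M : zmodType) (h : edge G -> M) v :
    (forall e, e \notin inner (X :|: W) -> h e = 0) -> v \notin X :|: W -> divg h v = 0.
  move=> h0 vU; apply: big1 => e _; case: (boolP (e \in inner (X :|: W))).
    rewrite inE => /andP[sU tU].
    have -> : (src e == v) = false by apply: contraNF vU => /eqP<-.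
    have -> : (tgt e == v) = false by apply: contraNF vU => /eqP<-.
    by rewrite subrr.
  by move=> /h0->; rewrite !mul0rn subrr.
split.
  (* [e1] carries the whole demand of [W] across, which leaves both sides balanced. *)
  move=> b b0 sumb; pose m := \sum_(v in W) b v.
  pose c := if src e1 \in W then m else - m.
  pose g1 e : 'Z_3 := c *+ (e == e1).
  have g1U e : e \notin inner (X :|: W) -> g1 e = 0.
    by rewrite /g1; case: eqP => // ->; rewrite (btwU _ e1XW).
  have [|||gX [gW [gX0 gW0 gXW]]] :=
      @solvable_disjoint _ _ _ _ _ (fun v => b v - divg g1 v) dXW solX (solD _).
  - by move=> v vU; rewrite b0 // div_out // subrr.
  - by rewrite sumrB sumb sum_divgT subrr.
  - rewrite sumrB sum_single // /c -/m.
    by case: (src e1 \in W); rewrite ?opprK subrr.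
  exists (fun e => gX e + gW e + g1 e); split=> [e eU|v].
    rewrite gX0 ?gW0 ?g1U ?addr0 //.
      exact: contra (subsetP sDW e) (contra (subsetP inWU e) eU).
    exact: contra (subsetP inXU e) eU.
  by rewrite !divgD gXW subrK.
exists (C :|: D); split.
- by rewrite subUset (subset_trans sCX) // (subset_trans sDW).
- have -> : C :|: D = symdiff C D; last exact: even_symdiff.
  apply/setP => e; rewrite in_symdiff inE.
  case: (boolP (e \in C)) => //= /(subsetP sCX); rewrite inE => /andP[sX _].
  apply/esym/negP => /(subsetP sDW); rewrite inE => /andP[sW _].
  by have := notX _ sW; rewrite sX.
move=> p.
(* These edges get an allowed value at once. [D] joins the exempt even set, so it is free to absorb
   divergence inside [W]; [e1] and [e2] balance [W] as a whole. *)
pose h0 e : 'Z_3 :=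
  if (e \in inner (X :|: W)) && (e \notin inner X) && (e \notin D)
     && (e != e1) && (e != e2) then p e + 1 else 0.
have [x1 [x2 [x1p x2p x12]]] :=
  two_values (\sum_(v in W) divg h0 v) (p e1) (p e2) (src e1 \in W) (src e2 \in W).
pose h e := h0 e + x1 *+ (e == e1) + x2 *+ (e == e2).
have h_out e : e \notin inner (X :|: W) -> h e = 0.
  move=> eU; rewrite /h /h0 (negPf eU) /= add0r.
  case: eqP eU => [->|_]; first by rewrite (btwU _ e1XW).
  by case: eqP => [->|_]; rewrite ?(btwU _ e2XW) ?addr0.
have h_in e : (e \in inner X) || (e \in D) -> h e = 0.
  move=> eXD; rewrite /h /h0.
  have -> : (e == e1) = false.
    by apply: contraTF eXD => /eqP->; rewrite negb_or btwX ?btwD.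
  have -> : (e == e2) = false.
    by apply: contraTF eXD => /eqP->; rewrite negb_or btwX ?btwD.
  by case/orP: eXD => -> /=; rewrite ?andbF /= !addr0.
have h_p e : e \in inner (X :|: W) -> e \notin inner X -> e \notin D -> h e != p e.
  move=> eU eX eD; rewrite /h /h0 eU eX eD /=.
  case: (eqVneq e e1) => [->|ne1] /=; first by rewrite (negPf e12) add0r addr0.
  case: (eqVneq e e2) => [->|ne2] /=; first by rewrite !add0r.
  by rewrite !addr0 -subr_eq0 addrAC subrr add0r oner_neq0.
have [|||gX [gW [gX0 gW0 gXW]]] :=
    @solvable_disjoint _ _ _ _ _ (fun v => - divg h v) dXW solX (solD _).
- by move=> v vU; rewrite div_out ?oppr0.
- by rewrite sumrN sum_divgT oppr0.
- rewrite sumrN /h; under eq_bigr do rewrite !divgD.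
  by rewrite !big_split /= !sum_single // x12 oppr0.
(* The flow [gX] already sits on the edges inside [X], so the forbidden values there are shifted by
   it. *)
have [g [g0 divg0 gp]] := gC (fun e => p e - gX e).
exists (fun e => h e + (gX e + gW e) + g e); split.
- move=> e eU; rewrite h_out // gX0 ?gW0 ?g0 ?addr0 //.
  + exact: contra (subsetP inXU e) eU.
  + exact: contra (subsetP sDW e) (contra (subsetP inWU e) eU).
  + exact: contra (subsetP inXU e) eU.
- by move=> v; rewrite divgD divg0 addr0 (divgD h) (divgD gX) gXW subrr.
- move=> e eU; rewrite inE negb_or => /andP[eC eD].
  rewrite (gW0 _ eD) addr0; case: (boolP (e \in inner X)) => eX.
    by rewrite h_in ?eX // add0r addrC -(subrK (gX e) (p e)) (inj_eq (addIr _)) gp.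
  by rewrite gX0 // g0 // !addr0 h_p.
Qed.

End Growth.

Section SixFlow.
Variable G : multigraph.
Implicit Types (e : edge G) (v x y u w : vertex G) (S X W L U : {set vertex G}).
Implicit Types (F C D Y : {set edge G}).

Definition cut S := [set e | in_cut S e].

Lemma sum_divg_cut (M : zmodType) (f : edge G -> M) S :
  \sum_(v in S) divg f v = \sum_(e in cut S) (if src e \in S then f e else - f e).
Proof.
rewrite sum_divg [RHS]big_mkcond; apply: eq_bigr => e _; rewrite inE in_cutE.
by case: (src e \in S); case: (tgt e \in S) => //=; rewrite ?subr0 ?sub0r ?subrr.
Qed.

Lemma in_between X W e : (e \in between X W) =
  (src e \in X) && (tgt e \in W) || (src e \in W) && (tgt e \in X).
Proof. by rewrite inE. Qed.

(* L is a minimal set outside X with at most one edge to the rest outside X; such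
   an L is 2-edge-connected and sends two edges to X. *)
Lemma growth_step U X :
  inner U = setT -> X \subset U -> X != set0 -> X != U ->
  (forall S, S \subset U -> S != set0 -> S != U -> (2 < #|cut S|)%N) ->
  exists W D e1 e2, [/\ W \subset U :\: X, W != set0, D \subset inner W, even_set D &
    [/\ forall M, solvable M D W,
        e1 \in between X W, e2 \in between X W & e1 != e2]].
Proof.
move=> inU sXU X0 XU cut3.
have endU e : (src e \in U) && (tgt e \in U).
  by have := in_setT e; rewrite -inU inE.
pose P L := [&& L != set0, L \subset U :\: X & (#|between L ((U :\: X) :\: L)| <= 1)%N].
have P0 : P (U :\: X).
  rewrite /P subxx setDv setD_eq0 /=; apply/andP; split.
    by apply: contraNN XU => sUX; rewrite eqEsubset sXU.
  by rewrite (_ : between _ _ = set0) ?cards0 //; apply/setP => e; rewrite !inE !andbF.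
have [L /and3P[L0 sL cutL] minL] := @arg_minnP _ _ P (fun L => #|L|) P0.
pose O := (U :\: X) :\: L.
have LU v : v \in L -> (v \in U) && (v \notin X).
  by move=> /(subsetP sL); rewrite inE andbC.
have sLU : L \subset U by apply: subset_trans sL (subsetDl _ _).
have LneU : L != U.
  have [x xX] := set0Pn _ X0; apply/eqP => LU_eq; have := LU x.
  by rewrite LU_eq xX (subsetP sXU) // => /(_ isT).
have : (1 < #|between X L|)%N.
  have : (#|cut L| <= #|between X L| + #|between L O|)%N.
    apply: leq_trans (leq_card_setU _ _); apply/subset_leq_card/subsetP => e.
    have := endU e; rewrite !inE in_cutE.
    have := LU (src e); have := LU (tgt e).
    case: (src e \in L); case: (tgt e \in L); case: (src e \in U); case: (tgt e \in U);
      case: (src e \in X); case: (tgt e \in X) => //=; by do 2!move/(_ isT).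
  have := cut3 L sLU L0 LneU; move: (cutL : (#|between L O| <= 1)%N).
  by do 3!move: (#|_|); clear; lia.
case/card_gt1P => e1 [e2 [e1X e2X e12]].
have end_in e : e \in between X L -> exists2 u, u \in L & (src e == u) || (tgt e == u).
  by rewrite inE => /orP[/andP[_ tL]|/andP[sL' _]];
     [exists (tgt e) | exists (src e)]; rewrite ?eqxx ?orbT.
have [u uL e1u] := end_in _ e1X; have [v vL e2v] := end_in _ e2X.
have [|D0 [sD0 evD0 uv]] := connected_even_subset uL vL.
  move=> S sSL uS vS.
  have smaller (R : {set vertex G}) : R \subset L -> R != set0 -> R != L ->
      (1 < #|between R ((U :\: X) :\: R)|)%N.
    move=> sRL R0 RL; rewrite ltnNge; apply/negP => cutR.
    have := minL R; rewrite /P R0 (subset_trans sRL sL) cutR => /(_ isT).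
    by rewrite leqNgt proper_card // properEneq RL.
  (* By minimality [S] and [L :\: S] each send at least two edges to the rest outside [X], and at
     most one of all these goes to [O]. With k edges between the two sets, 4 is at most 2k + 1. *)
  have hS : (1 < #|between S ((U :\: X) :\: S)|)%N.
    by apply: smaller => //; [apply/set0Pn; exists u | apply: contraNneq vS => ->].
  have hLS : (1 < #|between (L :\: S) ((U :\: X) :\: (L :\: S))|)%N.
    apply: smaller; first exact: subsetDl.
      by apply/set0Pn; exists v; rewrite inE vS.
    by apply/negP => /eqP/setP/(_ u); rewrite inE uS uL.
  have c1 : (#|between S ((U :\: X) :\: S)| <= #|between S (L :\: S)| + #|between S O|)%N.
    apply: leq_trans (leq_card_setU _ _); apply/subset_leq_card/subsetP => e.
    rewrite !inE.
    have := subsetP sSL (src e); have := subsetP sSL (tgt e).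
    have := LU (src e); have := LU (tgt e).
    case: (src e \in L); case: (tgt e \in L); case: (src e \in U); case: (tgt e \in U);
      case: (src e \in X); case: (tgt e \in X); case: (src e \in S);
      case: (tgt e \in S) => //=;
      do ?[by move/(_ isT) | move=> _].
  have c2 : (#|between (L :\: S) ((U :\: X) :\: (L :\: S))|
             <= #|between S (L :\: S)| + #|between (L :\: S) O|)%N.
    apply: leq_trans (leq_card_setU _ _); apply/subset_leq_card/subsetP => e.
    rewrite !inE.
    have := subsetP sSL (src e); have := subsetP sSL (tgt e).
    have := LU (src e); have := LU (tgt e).
    case: (src e \in L); case: (tgt e \in L); case: (src e \in U); case: (tgt e \in U);
      case: (src e \in X); case: (tgt e \in X); case: (src e \in S);
      case: (tgt e \in S) => //=;
      do ?[by move/(_ isT) | move=> _].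
  have c3 : (#|between S O| + #|between (L :\: S) O| <= #|between L O|)%N.
    rewrite -cardsUI (_ : _ :&: _ = set0) ?cards0 ?addn0.
      apply/subset_leq_card/subsetP => e; rewrite /O !inE.
    have := subsetP sSL (src e); have := subsetP sSL (tgt e).
    case: (src e \in L); case: (tgt e \in L); case: (src e \in U); case: (tgt e \in U);
      case: (src e \in X); case: (tgt e \in X); case: (src e \in S);
      case: (tgt e \in S) => //=;
      do ?[by move/(_ isT) | move=> _].
    apply/setP => e; rewrite /O !inE.
    have := subsetP sSL (src e); have := subsetP sSL (tgt e).
    case: (src e \in L); case: (tgt e \in L); case: (src e \in U); case: (tgt e \in U);
      case: (src e \in X); case: (tgt e \in X); case: (src e \in S);
      case: (tgt e \in S) => //=;
      do ?[by move/(_ isT) | move=> _].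
  move: hS hLS c1 c2 c3 (cutL : (#|between L O| <= 1)%N).
  do 6!move: (#|_|); clear; lia.
(* [D0] need not connect all of [L]; it connects the component of [u], which still contains an end
   of [e1] and one of [e2]. *)
pose W := component D0 u; pose D := D0 :&: inner W.
have sWL : W \subset L by apply: component_sub.
have wW e w : e \in between X L -> w \in W -> (src e == w) || (tgt e == w) ->
    e \in between X W.
  move=> + wW ew; have wL := subsetP sWL w wW; have /andP[_ /negPf wX] := LU w wL.
  by rewrite !in_between; case/orP: ew => /eqP->; rewrite wW wL wX ?andbF ?orbF //= => ->.
exists W, D, e1, e2; split.
- exact: subset_trans sWL sL.
- by apply/set0Pn; exists u; rewrite inE connect0.
- exact: subsetIr.
- exact: even_component.
split=> //.
- move=> M; apply: solvable_connect => x y; rewrite !inE => ux uy.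
  apply: (@connect_trans _ _ u); last exact: component_inner.
  by rewrite (@adj_connect_sym G); apply: component_inner.
- by apply: wW e1X _ e1u; rewrite inE connect0.
- by apply: wW e2X _ e2v; rewrite inE.
Qed.
End SixFlow.

(** Vertex and edge types stay the same: vertices outside the image of [r] remain as isolated ones,
    edges between merged vertices become loops, and values on edges carry over unchanged. *)
Definition identify (G : multigraph) (r : vertex G -> vertex G) : multigraph :=
  Multigraph (fun e : edge G => (r (src e), r (tgt e))).

Lemma divg_merge (G : multigraph) r (M : zmodType) (f : edge G -> M) v :
  divg (G := identify r) f v = \sum_(w in r @^-1: [set v]) divg f w.
Proof. by rewrite sum_divg; apply: eq_bigr => e _; rewrite !inE. Qed.

Lemma cut_merge (G : multigraph) r (S : {set vertex G}) :
  cut (G := identify r) S = cut (r @^-1: S).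
Proof. by apply/setP => e; rewrite !inE !in_cutE !inE. Qed.

Lemma tractable_all (G : multigraph) (U : {set vertex G}) :
  inner U = setT -> U != set0 ->
  (forall S : {set vertex G}, S \subset U -> S != set0 -> S != U ->
     (2 < #|cut S|)%N) -> tractable U.
Proof.
move=> inU /set0Pn[x xU] cut3.
suff grow n X : (#|U :\: X| < n)%N -> X \subset U -> X != set0 -> tractable X ->
    tractable U.
  apply: (grow _ [set x] (ltnSn _)); rewrite ?sub1set //; last exact: tractable1.
  by apply/set0Pn; exists x; rewrite inE.
elim: n X => // n IHn X leUX sXU X0 trX.
case: (eqVneq X U) => [<- //|XU].
have [W [D [e1 [e2 [sW W0 sD evD [solD e1X e2X e12]]]]]] :=
  growth_step inU sXU X0 XU cut3.
have [sWU dWX] : W \subset U /\ [disjoint X & W].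
  by apply/andP; rewrite disjoint_sym -subsetD.
apply: (IHn (X :|: W)); last exact: (tractableU trX dWX sD evD solD e1X e2X e12).
- rewrite ltnS in leUX; apply: leq_trans leUX; apply/proper_card/properP; split.
    by apply: setDS; apply: subsetUl.
  have [w wW] := set0Pn _ W0; exists w; last by rewrite !inE wW orbT.
  by rewrite inE (disjointFl dWX wW) (subsetP sWU).
- by rewrite subUset sXU.
- by apply: contraNneq X0 => /eqP; rewrite setU_eq0 => /andP[].
Qed.

(* A cut with two edges forces equal values, up to sign, on them, so that one of
   them can be contracted. *)
Lemma six_flow (G : multigraph) :
  (forall S : {set vertex G}, #|cut S| != 1%N) ->
  exists f : edge G -> bool * 'Z_3, divg f =1 (fun=> 0) /\ forall e, f e != 0.
Proof.
have : inner (G := G) setT = setT by apply/setP => e; rewrite !inE.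
(* Identification keeps the vertex type, so the induction is on the size of a set [U] that contains
   all ends of edges. *)
have [n] := ubnP #|[set: vertex G]|; move: [set: vertex G] => U.
elim: n G U => // n IHn G U leUn inU cut1.
have endU e : (src e \in U) && (tgt e \in U).
  by have := in_setT e; rewrite -inU inE.
case: (set_0Vmem U) => [U0|[x0 x0U]].
  exists (fun=> 0); split=> [v|e]; first exact: divg0.
  by have := endU e; rewrite U0 inE.
case: (boolP [exists S : {set vertex G},
         [&& S \subset U, S != set0, S != U & (#|cut S| <= 2)%N]]); last first.
  rewrite negb_exists => /forallP noS.
  have [|||_ [C [_ evC gC]]] := @tractable_all G U => //.
  - by apply/set0Pn; exists x0.
  - by move=> S sSU S0 SU; have := noS S; rewrite sSU S0 SU -ltnNge.
  have [g [_ divg_g gC0]] := gC (fun=> 0).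
  exists (fun e => (e \in C, g e)); split=> [v|e].
    apply: injective_projections.
      rewrite -(divg_additive (@fst bool 'Z_3)) -[RHS]((even_setP C).1 evC v).
      by apply: eq_divg => e; rewrite /ind /=; case: (e \in C).
    by rewrite -(divg_additive (@snd bool 'Z_3)) -[RHS](divg_g v).
  apply/eqP => -[eC ge]; have := gC0 e; rewrite inU inE eC ge eqxx.
  by move=> /(_ isT isT).
case/existsP => S /and4P[sSU S0 SU cut2].
have merge_step x y : x \in S -> y \in U -> y \notin S ->
    exists f : edge G -> bool * 'Z_3,
      [/\ forall v, v != x -> v != y -> divg f v = 0,
          divg f x + divg f y = 0 & forall e, f e != 0].
  move=> xS yU yS; have xy : x != y by apply: contraNneq yS => <-.
  pose r w := if w == y then x else w.
  have xU := subsetP sSU x xS.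
  have rU w : w \in U -> r w \in U :\ y.
    by rewrite /r !inE; case: (eqVneq w y) => [_ _|-> //]; rewrite xy.
  have [||| f [div0 f0]] := IHn (identify r) (U :\ y).
  - by move: leUn; rewrite (cardsD1 y U) yU.
  - apply/setP => e; rewrite in_setT inE; have /andP[sU tU] := endU e.
    by rewrite /= !rU.
  - by move=> R; rewrite cut_merge.
  exists f; split=> //.
    move=> v vx vy; rewrite -[RHS](div0 v) (divg_merge (r := r)).
    rewrite (_ : _ @^-1: _ = [set v]) ?big_set1 //; apply/setP => w.
    rewrite !inE /r; case: (eqVneq w y) => [->|//].
    by rewrite ![_ == v]eq_sym (negPf vx) (negPf vy).
  rewrite -[RHS](div0 x) (divg_merge (r := r)).
  rewrite (_ : _ @^-1: _ = [set x; y]) ?big_setU1 ?big_set1 ?inE //.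
  apply/setP => w; rewrite !inE /r.
  by case: (eqVneq w y) => [->|_]; rewrite ?eqxx ?orbT ?orbF.
have sumS (h : vertex G -> bool * 'Z_3) x y : x \in S -> y \notin S ->
    (forall v, v != x -> v != y -> h v = 0) -> \sum_(v in S) h v = h x.
  move=> xS yS h0; rewrite (bigD1 x) //= big1 ?addr0 // => v /andP[vS vx].
  by apply: h0 => //; apply: contraNneq yS => <-.
case: (set_0Vmem (cut S)) => [cutS|[e1 e1S]].
  have [x xS] := set0Pn _ S0.
  have [y yU yS] : exists2 y, y \in U & y \notin S.
    by apply/subsetPn; apply: contraNN SU => sUS; rewrite eqEsubset sSU.
  have [f [div0 divxy f0]] := merge_step x y xS yU yS.
  have divx : divg f x = 0.
    by rewrite -(sumS _ x y) // sum_divg_cut cutS big_set0.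
  exists f; split=> // v; case: (eqVneq v x) => [-> //|vx].
  case: (eqVneq v y) => [->|/(div0 v vx) //].
  by move: divxy; rewrite divx add0r.
have [e2 e2S e21] : exists2 e2, e2 \in cut S & e2 != e1.
  have : (0 < #|cut S :\ e1|)%N.
    have := cut1 S; have := cut2; rewrite (cardsD1 e1 (cut S)) e1S.
    by case: #|_|.
  by case/card_gt0P => e2; rewrite in_setD1 => /andP[? ?]; exists e2.
have cutE : cut S = [set e1; e2].
  apply/eqP; rewrite eq_sym eqEcard subUset !sub1set e1S e2S cards2 eq_sym e21.
  exact: cut2.
pose s := src e1 \in S.
pose x := if s then src e1 else tgt e1; pose y := if s then tgt e1 else src e1.
have [xS yS yU] : [/\ x \in S, y \notin S & y \in U].
  have /andP[sU tU] := endU e1; move: e1S; rewrite inE in_cutE /x /y /s.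
  by case: (boolP (src e1 \in S)).
have [f [div0 divxy f0]] := merge_step x y xS yU yS.
(* After the identification [e1] is a loop, so its value has no bearing on the balance there; [c]
   corrects it so that [x] and [y] balance separately. *)
pose c := if s then - divg f x else divg f x.
pose f' e := f e + c *+ (e == e1).
have xy : x != y by apply: contraNneq yS => <-.
have div0' : divg f' =1 (fun=> 0).
  move=> v; rewrite divgD divg_single.
  rewrite (_ : c *+ _ - _ = - divg f x *+ (x == v) + divg f x *+ (y == v)).
    case: (eqVneq x v) => [<-|xv].
      by rewrite eq_sym (negPf xy) addr0 subrr.
    case: (eqVneq y v) => [<-|yv]; first by rewrite mulr0n add0r addrC.
    by rewrite !addr0 div0 // eq_sym.
  rewrite /c /x /y /s; case: (src e1 \in S); first by rewrite !mulNrn opprK.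
  by rewrite mulNrn addrC.
exists f'; split=> // e; rewrite /f'; case: (eqVneq e e1) => [->|_]; last first.
  by rewrite addr0.
(* The cut consists of [e1] and [e2], so the corrected value on [e1] is, up to sign, the nonzero
   value on [e2]. *)
have sum0 : (if src e1 \in S then f' e1 else - f' e1)
    + (if src e2 \in S then f' e2 else - f' e2) = 0.
  have := sum_divg_cut f' S; rewrite big1 // cutE big_setU1 ?inE 1?eq_sym //.
  by rewrite big_set1 => <-.
apply/eqP => z; move: sum0; rewrite /f' eqxx (negPf e21) addr0 z oppr0 if_same add0r.
have := f0 e2; case: ifP => _ /eqP f2N0 sum0; apply: f2N0; first by [].
by rewrite -[LHS]opprK sum0 oppr0.
Qed.

(** * Covers by even sets *)

Lemma ex_le_average (I : finType) (i0 : I) (F : I -> nat) :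
  exists i, (#|I| * F i <= \sum_j F j)%N.
Proof.
case: (@arg_minnP I i0 xpredT F isT) => i _ min_i; exists i.
by rewrite -sum_nat_const; apply: leq_sum => j _; apply: min_i.
Qed.

Lemma sum_ord3 (F : 'Z_3 -> nat) :
  (\sum_t F t = F 0%R + F 1%R + F (- 1)%R)%N.
Proof.
rewrite 2!big_ord_recr big_ord1 /=.
by congr (F _ + F _ + F _)%N; apply: val_inj.
Qed.

Lemma divg_mull (G : multigraph) (R : pzRingType) (a : R) (f : edge G -> R) v :
  divg (fun e => a * f e) v = a * divg f v.
Proof. by rewrite mulr_sumr; apply: eq_bigr => e _; rewrite mulrBr !mulrnAr. Qed.

Lemma even_dvd (G : multigraph) (C : {set edge G}) v :
  even_set C -> (2 %| divg (ind int C) v)%Z.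
Proof.
move=> evC; rewrite dvdzE /= dvdn2 -odd_intr -[_%:~R](divg_additive (intmul 1)).
apply/negP; apply/negP; rewrite -[X in ~~ X](_ : divg (ind bool C) v = _).
  by rewrite ((even_setP C).1 evC).
by apply: eq_divg => e; rewrite /ind; case: (e \in C).
Qed.

(* Shifting the Z/3 part of the flow along a +-1 flow on the even set C makes it
   vanish on each edge of C for exactly one of the three shifts. *)
Lemma six_flow_cover (G : multigraph) :
  (forall S : {set vertex G}, #|cut S| != 1%N) ->
  exists (C : {set edge G}) (D1 D2 : 'Z_3 -> {set edge G}),
    [/\ even_set C, forall t, even_set (D1 t), forall t, even_set (D2 t) &
        forall e, (\sum_t ((e \in D1 t) || (e \in D2 t)) = 3 - (e \in C))%N].
Proof.
move=> /six_flow[f [divf f0]].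
pose C := [set e | (f e).1].
have evC : even_set C.
  apply: even_flow => v.
  by rewrite (divg_additive (@fst bool 'Z_3)) divf.
have [//|Y sYC CY] := @equitable_subset G C 2 isT.
  by move=> v; apply: even_dvd.
(* The value is 1 on [C :\: Y], -1 on [Y] and 0 outside [C]. *)
pose w e : 'Z_3 := (ind int C e - 2%:Z * ind int Y e)%:~R.
have divw v : divg w v = 0.
  rewrite (divg_additive (intmul (1 : 'Z_3))) divgB.
  by rewrite divg_mull -CY subrr.
pose g (t : 'Z_3) e : 'Z_3 := (f e).2 + t * w e.
have divg_g t : divg (g t) =1 (fun=> 0).
  move=> v; rewrite divgD (divg_additive (@snd bool 'Z_3)) divf add0r.
  by rewrite divg_mull divw mulr0.
have [t|D DP] := @fin_all_exists _ (fun=> {set edge G} * {set edge G})%type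
  (fun t D => [/\ even_set D.1, even_set D.2 &
    forall e, (e \in D.1) || (e \in D.2) = (g t e != 0)]) _.
  by have [D1 [D2 DP]] := flow3_cover (divg_g t); exists (D1, D2).
exists C, (fun t => (D t).1), (fun t => (D t).2); split=> //.
- by move=> t; case: (DP t).
- by move=> t; case: (DP t).
move=> e; transitivity (\sum_t (g t e != 0%R))%N.
  by apply: eq_bigr => t _; case: (DP t) => _ _ ->.
rewrite sum_ord3 /g mul0r mul1r mulN1r addr0 inE.
have := f0 e; rewrite /w /ind inE; have := subsetP sYC e; rewrite inE.
case: (f e) => [[] z] /=.
  by move=> _ _; case: (e \in Y); case: (Z3_cases z) => ->.
case: (e \in Y) => [/(_ isT) //|_]; rewrite subrr mulr0z oppr0 !addr0.
by move=> zN0; have -> : z != 0 by apply: contraNneq zN0 => ->.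
Qed.

Lemma degree_sub (G : multigraph) (A : {set edge G})
    (C : {set {e : edge G | e \in A}}) v :
  degree (val @: C) v =
  degree (G := Multigraph (fun e : {e : edge G | e \in A} => ends (val e))) C v.
Proof. by rewrite /degree big_imset //= => e1 e2 _ _; apply: val_inj. Qed.

Section CoverFamily.
Variables (G : multigraph) (A : {set edge G}).
Hypothesis bridgeless : forall S : {set vertex G}, #|cut S :&: A| != 1%N.

(** The edges of [A] form the edge type of a graph on the same vertices, whose cuts are those of [G]
    restricted to [A]. *)
Lemma six_flow_cover_sub :
  exists (C : {set edge G}) (D1 D2 : 'Z_3 -> {set edge G}),
    [/\ C \subset A /\ even_set C,
        forall t, D1 t \subset A /\ even_set (D1 t),
        forall t, D2 t \subset A /\ even_set (D2 t) &
        forall e, e \in A ->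
          (\sum_t ((e \in D1 t) || (e \in D2 t)) = 3 - (e \in C))%N].
Proof.
pose GA := Multigraph (fun e : {e : edge G | e \in A} => ends (val e)).
have pushP (C : {set edge GA}) : even_set C -> val @: C \subset A /\ even_set (val @: C).
  move=> evC; split=> [|v]; last by rewrite degree_sub.
  by apply/subsetP => _ /imsetP[e _ ->]; apply: valP.
have [|C [D1 [D2 [evC evD1 evD2 covD]]]] := @six_flow_cover GA.
  move=> S; rewrite -(card_imset _ val_inj) (_ : _ @: _ = @cut G S :&: A) //.
  apply/setP => e; rewrite in_setI; apply/imsetP/andP => [[e' + ->]|[eS eA]].
    by rewrite !inE; split; [| exact: valP].
  by exists (Sub e eA); rewrite ?SubK //; move: eS; rewrite !inE.
exists (val @: C), (fun t => val @: D1 t), (fun t => val @: D2 t).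
split; [exact: pushP | by move=> t; apply: pushP | by move=> t; apply: pushP |].
move=> e eA; have := covD (Sub e eA).
have mem (D : {set edge GA}) : (e \in val @: D) = (Sub e eA \in D).
  by rewrite -[in LHS](SubK {e : edge G | e \in A} eA) mem_imset //; apply: val_inj.
rewrite mem => <-; by apply: eq_bigr => t _; rewrite !mem.
Qed.

Lemma card_sub_sum (F : {set edge G}) : F \subset A -> #|F| = (\sum_(e in A) (e \in F))%N.
Proof.
move=> sFA; rewrite -sum1_card [RHS](big_setID F) /= [X in (_ + X)%N]big1 ?addn0.
  by rewrite (setIidPr sFA); apply: eq_bigr => e ->.
by move=> e; rewrite inE => /andP[/negPf->].
Qed.

Lemma symdiff_sub (F1 F2 : {set edge G}) :
  F1 \subset A -> F2 \subset A -> symdiff F1 F2 \subset A.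
Proof. by move=> s1 s2; rewrite subUset !(subset_trans (subsetDl _ _)). Qed.

(* Averaging over the translates of Q by the eight elements spanned by C, D1, D2,
   one of which contains any given edge. *)
Lemma half_translate (Q : {set edge G}) :
  exists X : {set edge G}, [/\ X \subset A, even_set X &
    (2 * #|symdiff Q X :&: A| <= #|A|)%N].
Proof.
have [C [D1 [D2 [[sC evC] sevD1 sevD2 cov]]]] := six_flow_cover_sub.
have [[sD1 evD1] [sD2 evD2]] := (sevD1 0, sevD2 0).
pose pick (b : bool) F : {set edge G} := if b then F else set0.
pose X (i : bool * bool * bool) :=
  symdiff (pick i.1.1 C) (symdiff (pick i.1.2 (D1 0)) (pick i.2 (D2 0))).
have [i] := ex_le_average (false, false, false) (fun i => #|symdiff Q (X i) :&: A|).
rewrite !card_prod card_bool => avg; exists (X i); split.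
- have subp b (F : {set edge G}) : F \subset A -> pick b F \subset A.
    by case: b => // _; apply: sub0set.
  by do 2?[apply: symdiff_sub]; apply: subp.
- have evp b (F : {set edge G}) : even_set F -> even_set (pick b F).
    by case: b => // _; apply: even_set0.
  by do 2?[apply: even_symdiff]; apply: evp.
(* Adding a generator that contains a given edge toggles this edge, so it lies in exactly four of
   the eight translates. *)
suff sum4 : (\sum_j #|symdiff Q (X j) :&: A| = 4 * #|A|)%N.
  by move: avg; rewrite sum4; lia.
under eq_bigr => j _.
  rewrite (card_sub_sum (subsetIr _ _)).
  over.
rewrite exchange_big -sum1_card big_distrr; apply: eq_bigr => e eA /=.
rewrite -(pair_bigA _ (fun (p : bool * bool) b =>
  nat_of_bool (e \in symdiff Q (X (p, b)) :&: A))) /=.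
rewrite -(pair_bigA _ (fun a1 a2 => \sum_(b : bool)
  nat_of_bool (e \in symdiff Q (X (a1, a2, b)) :&: A)))%N /=.
rewrite !big_bool /X /pick /= !in_setI !in_symdiff eA !inE.
have : (e \in C) || (e \in D1 0) || (e \in D2 0).
  apply/negPn/negP; rewrite !negb_or => /andP[/andP[eC e1] e2].
  have := cov _ eA; rewrite sum_ord3 (negPf eC) (negPf e1) (negPf e2) /=.
  by do 2!case: (_ || _).
by case: (e \in Q); case: (e \in C); case: (e \in D1 0); case: (e \in D2 0).
Qed.

(* In the 18 covers below every edge is covered 30 times altogether. *)
Lemma even_cover_five_thirds :
  exists cs : seq {set edge G},
    [/\ forall F : {set edge G}, F \in cs -> F \subset A /\ even_set F,
        forall e, e \in A -> exists2 F, F \in cs & e \in F &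
        (3 * \sum_(F <- cs) #|F| <= 5 * #|A|)%N].
Proof.
have [C [D1 [D2 [sevC sevD1 sevD2 cov]]]] := six_flow_cover_sub.
pose D3 t := symdiff (D1 t) (D2 t).
have sevS (F1 F2 : {set edge G}) :
    F1 \subset A /\ even_set F1 -> F2 \subset A /\ even_set F2 ->
    symdiff F1 F2 \subset A /\ even_set (symdiff F1 F2).
  move=> [s1 ev1] [s2 ev2]; by split; [apply: symdiff_sub | apply: even_symdiff].
pose covers t := [::
  [:: C; D1 t; D2 t]; [:: C; D1 t; D3 t]; [:: C; D2 t; D3 t];
  [:: D1 t; D2 t; symdiff C (D3 t)]; [:: D1 t; D3 t; symdiff C (D2 t)];
  [:: D2 t; D3 t; symdiff C (D1 t)]].
pose cs (i : 'Z_3 * 'I_6) := nth [::] (covers i.1) i.2.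
have sub_cs i (F : {set edge G}) : F \in cs i -> F \subset A /\ even_set F.
  have sevD3 t : D3 t \subset A /\ even_set (D3 t) by apply: sevS.
  rewrite /cs; case: i => t [[|[|[|[|[|[|//]]]]]] i /=];
    rewrite !inE => /or3P[] /eqP-> //; exact: sevS.
have [i] := ex_le_average (0, ord0) (fun i => \sum_(F <- cs i) #|F|)%N.
rewrite card_prod !card_ord => avg; exists (cs i); split; first exact: sub_cs.
  move=> e eA.
  have ec t : (e \in C) || (e \in D1 t) || (e \in D2 t).
    apply/negPn/negP; rewrite !negb_or => /andP[/andP[eC e1] e2].
    have := cov _ eA; rewrite (bigD1 t) //= (negPf eC) (negPf e1) (negPf e2) /= add0n.
    move=> sum3; have : (\sum_(i | i != t) ((e \in D1 i) || (e \in D2 i)) <= 2)%N.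
      rewrite -[X in (_ <= X)%N](_ : \sum_(i : 'Z_3 | i != t) 1 = 2)%N; last first.
        by rewrite sum1_card cardC1 card_ord.
      by apply: leq_sum => j _; apply: leq_b1.
    by rewrite sum3.
  (* An edge outside [C] is in two of [D1], [D2], [D3], hence in one of any two. An edge of [C]
     missed by two of them is missed by the third, their sum, and so lies in the sum of [C] and the
     third. *)
  apply/hasP; rewrite /cs; case: i {avg} => t [[|[|[|[|[|[|//]]]]]] i /=];
    rewrite /D3 ?in_symdiff; move: (ec t);
    by case: (e \in C); case: (e \in D1 t); case: (e \in D2 t).
suff sum30 : (\sum_j \sum_(F <- cs j) #|F| = 30 * #|A|)%N.
  have : (18 * \sum_(F <- cs i) #|F| <= 30 * #|A|)%N by rewrite -sum30.
  by lia.
transitivity (\sum_(j : 'Z_3 * 'I_6) \sum_(e in A) \sum_(F <- cs j) (e \in F))%N.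
  apply: eq_bigr => j _; rewrite exchange_big /=.
  apply: eq_big_seq => F Fj; apply: card_sub_sum; exact: (sub_cs j F Fj).1.
rewrite exchange_big -sum1_card big_distrr; apply: eq_bigr => e eA /=.
rewrite -(pair_bigA _ (fun t k =>
  \sum_(F <- nth [::] (covers t) (nat_of_ord k)) (e \in F)))%N /=.
(* For a fixed shift the six covers count an edge of the support 10 times if it is outside [C] and
   12 times if it is in [C]; an edge of [C] off the support counts 6 times. The three shifts give 10
   + 10 + 10 or 12 + 12 + 6, that is 30 either way, over 18 covers. *)
transitivity (\sum_(t : 'Z_3) (6 * (e \in C)
    + (10 - 4 * (e \in C)) * ((e \in D1 t) || (e \in D2 t))))%N.
  apply: eq_bigr => t _; rewrite !big_ord_recr big_ord0 /= !big_cons !big_nil.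
  by rewrite /D3 !in_symdiff; case: (e \in C); case: (e \in D1 t); case: (e \in D2 t).
rewrite big_split /= sum_nat_const card_ord -big_distrr /= cov //.
by case: (e \in C).
Qed.

End CoverFamily.

End Flows.

(** * Paths, cycles and barbells *)

Section Cycles.
Variable G : multigraph.
Implicit Types (e : edge G) (v x y u w : vertex G) (S X W L U : {set vertex G}).
Implicit Types (F C D Y N : {set edge G}) (p q : seq (edge G * vertex G)).

Lemma degreeU1 F e v : e \notin F ->
  degree (e |: F) v = (src e == v) + (tgt e == v) + degree F v.
Proof. by move=> eF; rewrite /degree big_setU1. Qed.

Lemma degreeU F D v : [disjoint F & D] ->
  degree (F :|: D) v = degree F v + degree D v.
Proof. by move=> dFD; rewrite /degree -bigU //=; apply: eq_bigl => e; rewrite !inE. Qed.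

Lemma degreeD F D v : D \subset F -> degree F v = degree D v + degree (F :\: D) v.
Proof. by move=> sDF; rewrite /degree (big_setID D) /= (setIidPr sDF). Qed.

Lemma mem_cov F e v : e \in F -> (src e == v) || (tgt e == v) -> v \in cov F.
Proof.
by move=> eF ev; rewrite inE; apply/exists_inP; exists e; rewrite // ![v == _]eq_sym.
Qed.

Lemma covP F v :
  reflect (exists2 e, e \in F & (src e == v) || (tgt e == v)) (v \in cov F).
Proof.
rewrite inE; apply: (iffP exists_inP) => -[e eF ev]; exists e => //.
  by rewrite ![_ == v]eq_sym.
by rewrite ![v == _]eq_sym.
Qed.

Lemma covS F D : F \subset D -> cov F \subset cov D.
Proof.
move=> sFD; apply/subsetP => v /covP[e eF ev].
by apply: mem_cov ev; apply: (subsetP sFD).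
Qed.

Lemma degree_gt0 F v : (0 < degree F v) = (v \in cov F).
Proof.
apply/idP/covP => [|[e eF ev]]; last first.
  by rewrite /degree (big_setD1 e) //= addn_gt0; move: ev; rewrite /src /tgt;
    case: eqP => //= _ ->.
move=> deg0; apply/exists_inP; apply: contraTT deg0 => noe.
rewrite -eqn0Ngt /degree big1 // => e eF.
have /norP[] : ~~ ((src e == v) || (tgt e == v)).
  by apply: contra noe => ev; apply/exists_inP; exists e.
by rewrite /src /tgt => /negPf-> /negPf->.
Qed.

Lemma path_edges_cons e y p : path_edges ((e, y) :: p) = e |: path_edges p.
Proof. by apply/setP => e'; rewrite !inE. Qed.

Lemma path_edges_nil : path_edges ([::] : seq (edge G * vertex G)) = set0.
Proof. by apply/setP => e'; rewrite !inE. Qed.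

Lemma walk_edge_ends x p e : is_walk x p -> e \in path_edges p ->
  (src e \in path_vertices x p) && (tgt e \in path_vertices x p).
Proof.
elim: p x => [|[e' y] p IHp] x; first by rewrite path_edges_nil inE.
rewrite /= path_edges_cons in_setU1 => /andP[xy wlk] /predU1P[->|/(IHp _ wlk)].
  have [[-> ->]|[-> ->]] := joins_endsP _ _ _ xy;
    by rewrite /path_vertices /= !inE !eqxx ?orbT.
by rewrite /path_vertices /= !(in_cons x) => /andP[-> ->]; rewrite !orbT.
Qed.

Lemma is_path_cons x e y p : is_path x ((e, y) :: p) =
  [&& joins e x y, x \notin path_vertices y p & is_path y p].
Proof. by rewrite /is_path /path_vertices /= -!andbA; congr (_ && _); rewrite andbCA. Qed.

(** The two correction terms lift the ends to degree 2; for the trivial path both fall on its only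
    vertex, so the formula covers this case too. *)
Lemma degree_path x p v : is_path x p ->
  degree (path_edges p) v + (v == x) + (v == path_end x p)
    = 2 * (v \in path_vertices x p).
Proof.
elim: p x => [|[e y] p IHp] x.
  by rewrite path_edges_nil /degree big_set0 mem_seq1; case: (v == x).
rewrite is_path_cons => /and3P[xy xp pth]; rewrite path_edges_cons degreeU1; last first.
  apply: contra xp => /(walk_edge_ends (andP pth).1) /andP[sp tp].
  by have [[<- _]|[_ <-]] := joins_endsP _ _ _ xy.
have := IHp _ pth; rewrite /path_vertices /path_end /= !(in_cons x) => IH.
have -> : (src e == v) + (tgt e == v) = (v == x) + (v == y).
  rewrite ![_ == v]eq_sym.
  by have [[-> ->]|[-> ->]] := joins_endsP _ _ _ xy; rewrite // addnC.
have vx : (v == x) && (v \in path_vertices y p) = false.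
  by apply/andP => -[/eqP->]; apply/negP.
by move: vx IH; rewrite /path_vertices; case: (v == x); case: (v \in _); lia.
Qed.

Lemma walk_connect x p v :
  is_walk x p -> v \in path_vertices x p -> connect (adj (path_edges p)) x v.
Proof.
elim: p x => [|[e y] p IHp] x.
  by rewrite /path_vertices mem_seq1 => _ /eqP->; apply: connect0.
rewrite /path_vertices /= in_cons path_edges_cons => /andP[xy wlk] /predU1P[->|vp].
  exact: connect0.
apply: (@connect_trans _ _ y).
  by apply: connect1; apply/adjP; exists e; rewrite // setU11.
by apply: sub_connect_adj (IHp _ wlk vp); apply: subsetUr.
Qed.

Lemma path_end_mem x p : path_end x p \in path_vertices x p.
Proof. exact: mem_last. Qed.

Lemma path_cov x p : is_walk x p -> p != [::] ->
  cov (path_edges p) = [set v in path_vertices x p].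
Proof.
case: p => // -[e y] p wlk _; apply/setP => v; rewrite [RHS]inE; apply/covP/idP.
  case=> e' e'p; have /andP[sp tp] := walk_edge_ends wlk e'p.
  by case/orP => /eqP<-.
move: wlk; elim: p x e y => [|[e' z] p IHp] x e y.
  rewrite /path_vertices /= andbT !inE => xy vxy.
  exists e; first by rewrite path_edges_cons setU11.
  by have [[-> ->]|[-> ->]] := joins_endsP _ _ _ xy; rewrite ![_ == v]eq_sym // orbC.
rewrite /is_walk -/is_walk => /andP[xy wlk].
rewrite /path_vertices in_cons => /predU1P[->|].
  exists e; first by rewrite path_edges_cons setU11.
  by have [[-> ->]|[-> ->]] := joins_endsP _ _ _ xy; rewrite eqxx ?orbT.
move=> /(IHp _ _ _ wlk)[e'' e''p ev]; exists e'' => //.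
by rewrite path_edges_cons in_setU1 e''p orbT.
Qed.

Lemma connect_to_path F x y : connect (adj F) x y ->
  exists p, [/\ is_path x p, path_end x p = y & path_edges p \subset F].
Proof.
case/connectP => q0 /shortenP[q pth unq _] yE.
suff [p [wlk pq sp]] : exists p,
    [/\ is_walk x p, [seq ey.2 | ey <- p] = q & path_edges p \subset F].
  by exists p; rewrite /is_path /path_vertices /path_end wlk pq.
elim: q x pth {unq yE} => [|z q IHq] x /=.
  by exists [::]; rewrite path_edges_nil sub0set.
case/andP => /adjP[e eF xz] /IHq[p [wlk pq sp]]; exists ((e, z) :: p).
by rewrite /= xz wlk pq path_edges_cons subUset sub1set eF.
Qed.

Lemma is_cycleI C W x : x \in W ->
  (forall v, v \in W -> connect (adj C) x v) ->
  (forall v, degree C v = 2 * (v \in W)) -> is_cycle C /\ cov C = W.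
Proof.
move=> xW conW degC.
have covC : cov C = W.
  by apply/setP => v; rewrite -degree_gt0 degC; case: (v \in W).
split=> //; rewrite /is_cycle /connected_sub covC; apply/andP; split.
  apply/andP; split; first by apply/set0Pn; exists x.
  apply/forall_inP => a aW; apply/forall_inP => b bW.
  by apply: (@connect_trans _ _ x); [rewrite adj_connect_sym|]; apply: conW.
by apply/forall_inP => v vW; rewrite degC vW.
Qed.

Lemma cycle_degree C v : is_cycle C -> degree C v = 2 * (v \in cov C).
Proof.
case/andP => _ /forall_inP deg2; case: (boolP (v \in cov C)) => [/deg2/eqP //|].
by rewrite -degree_gt0 lt0n negbK => /eqP.
Qed.

Lemma cycle_connect C x y : is_cycle C -> x \in cov C -> y \in cov C ->
  connect (adj C) x y.
Proof. by case/andP => /andP[_ /forall_inP con] _ /con/forall_inP; apply. Qed.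

Lemma cycle_cov_neq0 C : is_cycle C -> cov C != set0.
Proof. by case/andP => /andP[]. Qed.

Lemma cycle_neq0 C : is_cycle C -> C != set0.
Proof.
move=> /cycle_cov_neq0/set0Pn[v /covP[e eC _]]; by apply/set0Pn; exists e.
Qed.

Lemma cycle_even C : is_cycle C -> even_set C.
Proof. by move=> cycC v; rewrite cycle_degree // mul2n odd_double. Qed.

(** Every vertex met by [D] already has degree 2 in [D], so no edge of [C] outside [D] touches it;
    connectedness of [C] does the rest. *)
Lemma cycle_even_sub C D : is_cycle C -> D \subset C -> even_set D -> D != set0 -> D = C.
Proof.
move=> cycC sDC evD /set0Pn[e0 e0D].
have degD v : v \in cov D -> degree D v = degree C v.
  rewrite -degree_gt0 => Dv; have := evD v; have := cycle_degree v cycC.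
  by have := degreeD v sDC; case: (v \in cov C); lia.
have closedD v e : v \in cov D -> e \in C -> (src e == v) || (tgt e == v) -> e \in D.
  move=> vD eC ev; apply/negPn/negP => eD; have := degreeD v sDC; rewrite degD //.
  have : 0 < degree (C :\: D) v.
    by rewrite degree_gt0; apply: mem_cov ev; rewrite inE eD.
  by lia.
have s0D : src e0 \in cov D by apply: (mem_cov e0D); rewrite eqxx.
apply/eqP; rewrite eqEsubset sDC; apply/subsetP => e eC.
have eS : src e \in cov C by apply: (mem_cov eC); rewrite eqxx.
have /connectP[q] := cycle_connect cycC (subsetP (covS sDC) _ s0D) eS.
elim: q (src e0) s0D => [|z q IHq] y yD /=.
  by move=> _ yE; apply: (closedD y) => //; rewrite yE eqxx.
case/andP => /adjP[e' e'C yz] pth; apply: IHq => //.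
have e'D : e' \in D.
  apply: (closedD y) => //.
  by have [[-> _]|[_ ->]] := joins_endsP _ _ _ yz; rewrite eqxx ?orbT.
by apply: (mem_cov e'D); have [[_ ->]|[-> _]] := joins_endsP _ _ _ yz; rewrite eqxx ?orbT.
Qed.

Lemma sum_divg_component F x :
  (\sum_(v in component F x) divg (ind bool F) v = 0)%R.
Proof.
rewrite sum_divg big1 // => e _; rewrite /ind; case: (boolP (e \in F)) => eF.
  by rewrite (component_end _ eF) GRing.subrr.
by rewrite !GRing.mul0rn GRing.subrr.
Qed.

(** The degrees over the component of [x] have even total, so it contains the only other odd
    vertex. *)
Lemma odd_pair_connect F x y : x != y ->
  (forall v, odd (degree F v) = (v == x) (+) (v == y)) -> connect (adj F) x y.
Proof.
move=> xy oddF; apply/negPn/negP => xyN; have := sum_divg_component F x.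
rewrite (bigD1 x) /= ?inE ?connect0 // -odd_degree oddF eqxx (negPf xy).
rewrite big1 // => v /andP[]; rewrite inE => xv vx.
rewrite -odd_degree oddF (negPf vx) /=; apply: contraNF xyN => /eqP<- //.
Qed.

Lemma odd_degree_path x p v : is_path x p ->
  odd (degree (path_edges p) v) = (v == x) (+) (v == path_end x p).
Proof.
move=> /(degree_path v) => E.
have := congr1 odd E; rewrite mul2n odd_double !oddD !oddb.
by case: (odd _); case: (v == x); case: (v == path_end x p).
Qed.

(** Without an edge [e] of [F] only the ends of [e] are odd, so a path in the rest joins them and
    closes up with [e]; for a loop this path is trivial. *)
Lemma even_has_cycle F : even_set F -> F != set0 ->
  exists2 C : {set edge G}, C \subset F & is_cycle C.
Proof.
move=> evF /set0Pn[e eF].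
have [|p [pth pE sp]] := @connect_to_path (F :\ e) (src e) (tgt e).
  case: (eqVneq (src e) (tgt e)) => [->|ne]; first exact: connect0.
  apply: odd_pair_connect => // v; have := evF v.
  rewrite -{1}(setD1K eF) degreeU1 ?setD11 // !oddD !oddb ![_ == v]eq_sym.
  by case: (odd _); case: (v == src e); case: (v == tgt e).
have ep : e \notin path_edges p.
  by apply/negP => /(subsetP sp); rewrite setD11.
exists (e |: path_edges p).
  by rewrite subUset sub1set eF (subset_trans sp) ?subD1set.
have wlk := (andP pth).1.
have [] := @is_cycleI (e |: path_edges p) [set v in path_vertices (src e) p]
  (src e) => //.
- by rewrite inE mem_head.
- move=> v; rewrite inE => /(walk_connect wlk); apply: sub_connect_adj.
  exact: subsetUr.
- move=> v; rewrite degreeU1 // inE -(degree_path v pth) pE ![_ == v]eq_sym; lia.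
Qed.

Lemma even_setD F D : D \subset F -> even_set F -> even_set D -> even_set (F :\: D).
Proof.
by move=> sDF evF evD v; have := evF v; rewrite (degreeD v sDF) oddD (negPf (evD v)).
Qed.

Lemma cycle_partition F : even_set F ->
  exists P : {set {set edge G}}, partition P F /\ forall C, C \in P -> is_cycle C.
Proof.
have [n] := ubnP #|F|; elim: n F => // n IHn F leF evF.
case: (eqVneq F set0) => [->|F0].
  exists set0; split=> [|C]; last by rewrite inE.
  by rewrite partition_set0.
have [C sCF cycC] := even_has_cycle evF F0.
have C0 := cycle_neq0 cycC.
have [||P [partP cycP]] := IHn (F :\: C).
- rewrite ltnS in leF; apply: leq_trans leF; apply: proper_card.
  have [e eC] := set0Pn _ C0; apply/properP; split; first exact: subsetDl.
  by exists e; rewrite ?(subsetP sCF) // inE eC.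
- by apply: even_setD => //; apply: cycle_even.
exists (C |: P); split=> [|D /setU1P[->|/cycP] //].
rewrite -(setID F C) (setIidPr sCF).
apply: partitionU1 => //; by rewrite disjoints_subset setCD subsetUr.
Qed.

End Cycles.

Section Barbells.
Variable G : multigraph.
Implicit Types (e : edge G) (v x y u w : vertex G) (S X W L U : {set vertex G}).
Implicit Types (F C D Y N H Q : {set edge G}) (p q : seq (edge G * vertex G)).

(** The path is cut at its first vertex in [S]. Together with [path_last], which drops everything
    before the last vertex in a set, this shortens a path between two disjoint cycles to one that
    meets each in a single vertex. *)
Lemma path_first x p S : is_path x p -> path_end x p \in S ->
  exists q, [/\ is_path x q, path_end x q \in S, path_edges q \subset path_edges p,
    {subset path_vertices x q <= path_vertices x p} &
    forall v, v \in path_vertices x q -> v \in S -> v = path_end x q].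
Proof.
elim: p x => [|[e y] p IHp] x.
  by move=> _ xS; exists [::]; split=> // v; rewrite mem_seq1 => /eqP.
case: (boolP (x \in S)) => xS.
  move=> _ _; exists [::]; rewrite path_edges_nil sub0set.
  split=> // v; last by rewrite mem_seq1 => /eqP.
  by rewrite mem_seq1 => /eqP->; apply: mem_head.
rewrite is_path_cons => /and3P[xy xp pth] /(IHp _ pth)[q [qpth qS sqp svq q1]].
exists ((e, y) :: q); rewrite is_path_cons xy qpth !path_edges_cons setUS //.
split=> //.
- by rewrite andbT; apply: contra xp => /svq.
- move=> v; rewrite /path_vertices /= !(in_cons x) => /predU1P[->|/svq].
    by rewrite eqxx.
  by rewrite /path_vertices => ->; rewrite orbT.
- move=> v; rewrite /path_vertices /= in_cons => /predU1P[->|]; last exact: q1.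
  by rewrite (negPf xS).
Qed.

Lemma path_last x p S : is_path x p -> has (mem S) (path_vertices x p) ->
  exists y q, [/\ is_path y q, path_end y q = path_end x p, y \in S,
    path_edges q \subset path_edges p /\ {subset path_vertices y q <= path_vertices x p} &
    forall v, v \in path_vertices y q -> v \in S -> v = y].
Proof.
elim: p x => [|[e y] p IHp] x.
  rewrite /path_vertices /= orbF => _ xS; exists x, [::].
  by split; [| | | split | move=> v /=; rewrite mem_seq1 => /eqP].
rewrite is_path_cons => /and3P[xy xp pth] hasS.
case: (boolP (has (mem S) (path_vertices y p))) => [/(IHp _ pth)|noS].
  case=> z [q [qpth qE zS [sqp svq] q1]]; exists z, q; split=> //.
  split; first by rewrite path_edges_cons (subset_trans sqp) ?subsetUr.
  by move=> v /svq vp; rewrite /path_vertices /= in_cons; apply/orP; right.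
have xS : x \in S by case/orP: hasS => // /(negP noS).
exists x, ((e, y) :: p); split; [| | | by split |] => //.
  by rewrite is_path_cons xy xp.
move=> v; rewrite /path_vertices /= in_cons => /predU1P[-> //|vp vS].
by case/hasP: noS; exists v.
Qed.

Variable sigma : signature G.

(** The given path may run through both cycles. A common vertex gives a short barbell at once;
    otherwise the path is trimmed, first at [C2] and then at [C1], and its edge set only shrinks. *)
Lemma barbell_of_path C1 C2 x p :
  negative_cycle sigma C1 -> negative_cycle sigma C2 ->
  C1 :&: C2 = set0 -> #|cov C1 :&: cov C2| <= 1 ->
  is_path x p -> x \in cov C1 -> path_end x p \in cov C2 ->
  exists F, [/\ barbell sigma F, C1 :|: C2 \subset F &
    #|F| <= #|C1| + #|C2| + #|path_edges p|].
Proof.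
move=> neg1 neg2 dis cov1 pth x1 p2.
have card12 : #|C1 :|: C2| = #|C1| + #|C2| by rewrite cardsU dis cards0 subn0.
move: cov1; rewrite leq_eqVlt ltnS leqn0 cards_eq0 => /orP[/eqP one|/eqP disv].
  exists (C1 :|: C2); split=> //; last by rewrite card12 leq_addr.
  by left; exists C1, C2.
have [q [qpth q2 sqp _ qlast]] := path_first pth p2.
have [|y [r [rpth rE y1 [srq svr] rfirst]]] := @path_last x q (cov C1) qpth.
  by apply/hasP; exists x => //; apply: mem_head.
exists (C1 :|: C2 :|: path_edges r); split.
- right; exists C1, C2, y, r; split=> //; split; apply/setP => v.
    rewrite in_setI in_set in_set1; apply/andP/eqP => [[vr v1]|->]; first exact: rfirst.
    by split=> //; apply: mem_head.
  rewrite in_setI in_set in_set1 rE; apply/andP/eqP => [[vr v2]|->].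
    by apply: qlast => //; apply: svr.
  by split=> //; rewrite -rE; apply: path_end_mem.
- exact: subsetUl.
- rewrite -card12; apply: leq_trans (leq_card_setU _ _) _.
  by rewrite leq_add2l subset_leq_card // (subset_trans srq).
Qed.

(* An arc of C1 between two vertices of C2 forms, with the arcs of C2, two cycles
   of opposite signs. *)
Lemma positive_cycle_of_two C1 C2 :
  negative_cycle sigma C1 -> negative_cycle sigma C2 ->
  C1 :&: C2 = set0 -> 1 < #|cov C1 :&: cov C2| ->
  exists2 C : {set edge G}, C \subset C1 :|: C2 & positive_cycle sigma C.
Proof.
move=> /andP[cyc1 odd1] /andP[cyc2 odd2] dis /card_gt1P[x [y0 [+ + xy0]]].
rewrite !in_setI => /andP[x1 x2] /andP[y1 y2].
have [p0 [pth0 p0E sp0]] := connect_to_path (cycle_connect cyc1 x1 y1).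
have [p [pth pE sp px pmid]] : exists p, [/\ is_path x p, path_end x p \in cov C2,
    path_edges p \subset C1, path_end x p != x &
    forall v, v \in path_vertices x p -> v \in cov C2 -> v = x \/ v = path_end x p].
  case: p0 pth0 p0E sp0 => [_ /eqP|[e z] p0]; first by rewrite (negPf xy0).
  rewrite is_path_cons => /and3P[xz xp pth] pE sp.
  (* The search for a vertex of [C2] starts behind [x], which lies on [C2] itself. *)
  have [|q [qpth qS sqp svq qlast]] := @path_first z p0 (cov C2) pth.
    by rewrite -[path_end _ _]/(path_end x ((e, z) :: p0)) pE.
  have xq : x \notin path_vertices z q by apply: contra xp => /svq.
  exists ((e, z) :: q); split=> //.
  - by rewrite is_path_cons xz xq.
  - by rewrite path_edges_cons (subset_trans _ sp) // path_edges_cons setUS.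
  - by apply: contraNneq xq => xE; rewrite -[x in x \in _]xE; apply: (path_end_mem z q).
  -  move=> v; rewrite /path_vertices /= in_cons => /predU1P[->|vq v2]; first by left.
  by right; apply: qlast.
set y := path_end x p in pE px pmid; move: (pE) => yC2.
have [q1 [qth1 q1E sq1]] := connect_to_path (cycle_connect cyc2 x2 yC2).
have odd_q1 v : odd (degree (path_edges q1) v) = (v == x) (+) (v == y).
  by rewrite (odd_degree_path _ qth1) q1E.
(* Without the arc [q1] the rest of [C2] has odd degree exactly at [x] and [y], which yields the
   second arc. *)
have [|q2 [qth2 q2E sq2]] := @connect_to_path _ (C2 :\: path_edges q1) x y.
  apply: odd_pair_connect => [|v]; first by rewrite eq_sym.
  have := cycle_even cyc2 v; rewrite (degreeD v sq1) oddD odd_q1.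
  by case: (odd _); case: (v == x); case: (v == y).
have sq2C : path_edges q2 \subset C2 by apply: subset_trans sq2 (subsetDl _ _).
have theta q : is_path x q -> path_end x q = y -> path_edges q \subset C2 ->
    is_cycle (path_edges p :|: path_edges q).
  move=> qth qE sq.
  have qN0 : q != [::] by apply: contraNneq px => q0; rewrite -qE q0.
  have vq2 v : v \in path_vertices x q -> v \in cov C2.
    move=> vq; apply: (subsetP (covS sq)).
    by rewrite (path_cov (andP qth).1 qN0) in_set.
  have dpq : [disjoint path_edges p & path_edges q].
    rewrite -setI_eq0 -subset0 -dis; apply: setISS => //.
  pose VU := [set v | (v \in path_vertices x p) || (v \in path_vertices x q)].
  apply: (proj1 (@is_cycleI _ _ VU x _ _ _)).
  - by rewrite in_set mem_head.
  - move=> v; rewrite in_set => /orP[vp|vq].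
      apply: sub_connect_adj (walk_connect (andP pth).1 vp); exact: subsetUl.
    apply: sub_connect_adj (walk_connect (andP qth).1 vq); exact: subsetUr.
  - move=> v; rewrite degreeU // in_set.
    have := degree_path v pth; have := degree_path v qth; rewrite qE -/y.
    have xyv : ~~ ((v == x) && (v == y)).
      by apply/andP => -[/eqP-> /eqP xy]; rewrite -xy eqxx in px.
    have endp : (v == x) || (v == y) ->
        (v \in path_vertices x p) && (v \in path_vertices x q).
      case/orP => /eqP->; first by rewrite !mem_head.
      by rewrite -{2}qE !path_end_mem.
    have pq : (v \in path_vertices x p) && (v \in path_vertices x q) ->
        (v == x) || (v == y).
      by case/andP => vp /vq2 /(pmid v vp) [] ->; rewrite eqxx ?orbT.
    move: xyv endp pq; move: (degree _ v) (degree _ v) => d1 d2.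
    move: (v == x) (v == y) (v \in path_vertices x p) (v \in path_vertices x q).
    by clear; do 4!case; move=> //= _ endp pq;
      first [by move: (endp isT) | by move: (pq isT) | lia].
have q12 : path_edges q1 :|: path_edges q2 = C2.
  have dq : [disjoint path_edges q1 & path_edges q2].
    rewrite disjoint_sym disjoints_subset (subset_trans sq2) //.
    by rewrite setDE subsetIr.
  apply: cycle_even_sub => //.
  - by rewrite subUset sq1.
  - move=> v; rewrite degreeU // oddD odd_q1 (odd_degree_path _ qth2) q2E addbb //.
  - have : path_edges q1 != set0.
      have /path_cov : is_walk x q1 by case/andP: qth1.
      have q1N0 : q1 != [::] by apply: contraNneq px => q0; rewrite -q1E q0.
      move=> /(_ q1N0) cE; apply: contraTneq (mem_head x [seq ey.2 | ey <- q1]) => q0.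
      have := congr1 (fun A : {set vertex G} => x \in A) cE; rewrite inE => <-.
      by rewrite q0; apply/covP => -[e]; rewrite inE.
    by apply: contraNneq => /eqP; rewrite setU_eq0 => /andP[].
pose sg D := odd #|D :&: neg_edges sigma|.
have sgU D D' : [disjoint D & D'] -> sg (D :|: D') = sg D (+) sg D'.
  rewrite -setI_eq0 => /eqP dD; rewrite /sg setIUl cardsU -setIIl dD.
  by rewrite set0I cards0 subn0 oddD.
have dp q : path_edges q \subset C2 -> [disjoint path_edges p & path_edges q].
  by move=> sq; rewrite -setI_eq0 -subset0 -dis; apply: setISS.
have odd12 : sg (path_edges q1) (+) sg (path_edges q2).
  rewrite -sgU; first by rewrite q12.
  rewrite disjoint_sym disjoints_subset (subset_trans sq2) //.
  by rewrite setDE subsetIr.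
case: (boolP (sg (path_edges p) == sg (path_edges q1))) => /eqP s1.
  exists (path_edges p :|: path_edges q1); first exact: setUSS.
  rewrite /positive_cycle theta //= -/(sg _) sgU; last exact: dp.
  by rewrite s1 addbb.
exists (path_edges p :|: path_edges q2); first exact: setUSS.
rewrite /positive_cycle theta //= -/(sg _) sgU; last exact: dp.
by move: s1 odd12; case: (sg (path_edges p)); case: (sg _); case: (sg _).
Qed.

End Barbells.

(** * Switching, joins, and signed circuits from even sets *)

Section SignedCovers.
Variable G : multigraph.
Implicit Types (e : edge G) (v x y u w : vertex G) (S X W L U : {set vertex G}).
Implicit Types (F C D Y N H Q A : {set edge G}).
Implicit Types (P : {set {set edge G}}) (sigma tau : signature G).

Lemma even_cut F S : even_set F -> ~~ odd #|F :&: cut S|.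
Proof.
move=> /even_setP evF; have : (\sum_(v in S) divg (ind bool F) v = 0)%R.
  by apply: big1 => v _; apply: evF.
rewrite sum_divg_cut => E; rewrite -odd_natr -sum1_card natr_sum.
rewrite -[X in ~~ X](_ : \sum_(e in cut S) (ind bool F e) = _)%R; last first.
  rewrite big_mkcond [RHS]big_mkcond; apply: eq_bigr => e _; rewrite in_setI /ind.
  by case: (e \in cut S); case: (e \in F).
rewrite (eq_bigr (fun e => if src e \in S then ind bool F e else - ind bool F e)%R) ?E //.
by move=> e _; case: ifP.
Qed.

Lemma in_cut_cut S e : (e \in cut S) = in_cut S e. Proof. by rewrite inE. Qed.

Lemma odd_symdiff F D : odd #|symdiff F D| = odd #|F| (+) odd #|D|.
Proof.
rewrite /symdiff cardsU (_ : _ :&: _ = set0); last first.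
  by apply/setP => e; rewrite !inE; case: (e \in F); case: (e \in D).
rewrite cards0 subn0 oddD -(cardsID D F) -(cardsID F D) (setIC D) !oddD.
by rewrite addbACA addbb.
Qed.

(** Switching changes signs along a cut, and a cut meets a cycle in an even number of edges. *)
Lemma odd_switch sigma tau C : sig_equiv sigma tau -> is_cycle C ->
  odd #|C :&: neg_edges tau| = odd #|C :&: neg_edges sigma|.
Proof.
move=> /existsP[X /forallP tauE] cycC.
have -> : C :&: neg_edges tau = symdiff (C :&: neg_edges sigma) (C :&: cut X).
  apply/setP => e; rewrite in_symdiff !in_setI in_cut_cut !in_set (eqP (tauE e)).
  by case: (e \in C) => //=; case: in_cut; case: (sigma e).
by rewrite odd_symdiff (negPf (even_cut X (cycle_even cycC))) addbF.
Qed.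

Lemma signed_circuit_switch sigma tau F : sig_equiv sigma tau ->
  signed_circuit tau F -> signed_circuit sigma F.
Proof.
move=> eq_st.
have neg C : negative_cycle tau C -> negative_cycle sigma C.
  by case/andP => cycC; rewrite /negative_cycle cycC (odd_switch eq_st cycC).
case=> [/andP[cycF]|[[C1 [C2 [/neg n1 /neg n2 h1 h2 h3]]]|]].
- by rewrite (odd_switch eq_st cycF) => oddF; left; rewrite /positive_cycle cycF.
- by right; left; exists C1, C2.
case=> C1 [C2 [x [p [[/neg n1 /neg n2] h1 h2 h3 h4]]]].
by right; right; exists C1, C2, x, p.
Qed.

Lemma sig_equiv_switch sigma tau X : sig_equiv sigma tau ->
  sig_equiv sigma [ffun e => in_cut X e (+) tau e].
Proof.
move=> /existsP[Y /forallP tauE]; apply/existsP; exists ((X :\: Y) :|: (Y :\: X)).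
apply/forallP => e; rewrite ffunE (eqP (tauE e)) !in_cutE !inE.
by case: (src e \in X); case: (src e \in Y); case: (tgt e \in X);
  case: (tgt e \in Y); case: (sigma e).
Qed.

(** Switching at [X] exchanges the negative and the positive edges of the cut and keeps all other
    signs. *)
Lemma minimal_signature_cut sigma tau X : sig_equiv sigma tau ->
  (forall rho, sig_equiv sigma rho -> #|neg_edges tau| <= #|neg_edges rho|) ->
  #|cut X :&: neg_edges tau| <= #|cut X :\: neg_edges tau|.
Proof.
move=> eq_st /(_ _ (sig_equiv_switch X eq_st)).
rewrite -(cardsID (cut X) (neg_edges tau)) -(cardsID (cut X) (neg_edges _)).
rewrite setIC (_ : neg_edges _ :\: cut X = neg_edges tau :\: cut X); last first.
  by apply/setP => e; rewrite !inE ffunE; case: in_cut.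
rewrite leq_add2r (_ : neg_edges _ :&: cut X = cut X :\: neg_edges tau) //.
by apply/setP => e; rewrite !inE ffunE; case: in_cut; case: (tau e).
Qed.

(** Once the only edge of a cut is deleted, [S] and its complement are unions of components, at
    least two in all, against one before. *)
Lemma bridgeless_cut S : two_edge_connected G -> #|cut S| != 1.
Proof.
case/andP => /andP[_ /forall_inP con] /forallP nobridge; apply/negP => /cards1P[e cutS].
case/negP: (nobridge e); rewrite /bridge.
have -> : n_comp (adj setT) (vertex G) = 1.
  rewrite -(n_comp_connect (@adj_connect_sym G setT) (src e)).
  apply: eq_n_comp_r => v; rewrite -[RHS]/(connect _ _ v); apply/esym.
  by move: (con (src e)); rewrite inE => /(_ isT)/forall_inP; apply; rewrite inE.
have closedS : closed (adj [set~ e]) S.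
  move=> x y /adjP[e']; rewrite !inE => e'e xy.
  have : e' \notin cut S by rewrite cutS inE.
  rewrite in_cut_cut in_cutE; have [[-> ->]|[-> ->]] := joins_endsP _ _ _ xy;
    by case: (x \in S); case: (y \in S).
have closedCS : closed (adj [set~ e]) [predC S].
  by move=> x y /closedS; rewrite !inE => /= ->.
rewrite (n_compC S).
have pos (a : {pred vertex G}) x : closed (adj [set~ e]) a -> x \in a ->
    0 < n_comp (adj [set~ e]) a.
  move=> cla xa; apply/card_gt0P; exists (fingraph.root (adj [set~ e]) x).
  rewrite !inE; apply/andP; split; first exact: roots_root (@adj_connect_sym G _) x.
  by rewrite -(closed_connect cla (connect_root _ x)).
have eS : in_cut S e by rewrite -in_cut_cut cutS inE.
move: eS; rewrite in_cutE; case: (boolP (src e \in S)) => sS /= tS.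
  by apply: (@leq_add 1 1); [apply: (pos _ (src e)) | apply: (pos _ (tgt e))].
by apply: (@leq_add 1 1); [apply: (pos _ (tgt e)) | apply: (pos _ (src e))].
Qed.

(** [Q] is a T-join for the set T encoded by [b]; total zero in [bool] says that T has even size. *)
Lemma join_exists F (b : vertex G -> bool) : (forall x y, connect (adj F) x y) ->
  (\sum_v b v = 0)%R ->
  exists2 Q : {set edge G}, Q \subset F & forall v, divg (ind bool Q) v = b v.
Proof.
move=> conF sumb; have [||g [g0 divg_g]] := @solvable_connect _ bool F setT _ b _ sumb.
- by move=> x y _ _; apply: conF.
- by move=> v; rewrite inE.
exists [set e | g e]; first by apply/subsetP => e; rewrite inE; apply: contraTT => /g0->.
move=> v; rewrite -divg_g; apply: eq_divg => e; rewrite /ind inE; by case: (g e).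
Qed.

Lemma divg_symdiff Q D v : even_set D ->
  divg (ind bool (symdiff Q D)) v = divg (ind bool Q) v.
Proof.
move=> evD; rewrite -[in RHS](GRing.addr0 (divg _ v)) -((even_setP D).1 evD v) -divgD.
by apply: eq_divg => e; rewrite /ind in_symdiff; case: (e \in Q); case: (e \in D).
Qed.

Lemma even_to_cycles A (cs : seq {set edge G}) :
  (forall F, F \in cs -> F \subset A /\ even_set F) ->
  exists ds : seq {set edge G},
    [/\ forall C, C \in ds -> C \subset A /\ is_cycle C,
        forall e, (exists2 F : {set edge G}, F \in cs & e \in F) ->
          exists2 C : {set edge G}, C \in ds & e \in C &
        \sum_(C <- ds) #|C| = \sum_(F <- cs) #|F|].
Proof.
elim: cs => [|F cs IHcs] subev.
  by exists [::]; split=> // [e [F]|]; rewrite ?inE ?big_nil.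
have [D Dcs|ds [cycds covds sumds]] := IHcs.
  by apply: subev; rewrite inE Dcs orbT.
have [sFA evF] := subev F (mem_head _ _).
have [P [partP cycP]] := cycle_partition evF.
exists (enum P ++ ds); split.
- move=> C; rewrite mem_cat mem_enum => /orP[CP|/cycds //].
  by split; [apply: subset_trans sFA; apply: partitionS partP CP | apply: cycP].
- move=> e [D]; rewrite inE => /predU1P[->|Dcs] eD.
    move: eD; rewrite -(cover_partition partP) => /bigcupP[C CP eC].
    by exists C; rewrite // mem_cat mem_enum CP.
  have [|C Cds eC] := covds e; first by exists D.
  by exists C; rewrite // mem_cat Cds orbT.
- by rewrite big_cat big_cons sumds big_enum /= (card_partition partP).
Qed.

Variable sigma : signature G.

Lemma partition_parity P H : partition P H ->
  (forall C, C \in P -> odd #|C :&: neg_edges sigma|) ->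
  odd #|P| = odd #|H :&: neg_edges sigma|.
Proof.
case/and3P => /eqP covP triv _ oddP.
have -> : #|H :&: neg_edges sigma| = \sum_(C in P) #|C :&: neg_edges sigma|.
  rewrite -sum1_card (eq_bigl (fun e => (e \in cover P) && (e \in neg_edges sigma))).
    rewrite big_trivIset_cond //; apply: eq_bigr => C _; rewrite -sum1_card.
    by apply: eq_bigl => e; rewrite in_setI.
  by move=> e; rewrite in_setI covP.
rewrite -sum1_card !(big_morph odd oddD (erefl (odd 0))).
by apply: eq_bigr => C /oddP->.
Qed.

(** Positive cycles are split off as long as there are any, which keeps the parity of the number of
    negative edges. A cycle partition of the remainder has only negative cycles, and two of them
    with two common vertices would yield another positive cycle. *)
Lemma signed_decomposition H : even_set H ->
  exists (ps : seq {set edge G}) P,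
    [/\ forall C, C \in ps -> positive_cycle sigma C,
        forall C, C \in P -> negative_cycle sigma C,
        {in P &, forall C D, C != D -> C :&: D = set0 /\ #|cov C :&: cov D| <= 1},
        forall e, e \in H -> exists2 C : {set edge G}, (C \in ps) || (C \in P) & e \in C &
        \sum_(C <- ps) #|C| + \sum_(C in P) #|C| = #|H| /\
        odd #|P| = odd #|H :&: neg_edges sigma|].
Proof.
have [n] := ubnP #|H|; elim: n H => // n IHn H leH evH.
case: (boolP [exists C : {set edge G}, (C \subset H) && positive_cycle sigma C]).
  case/existsP => C /andP[sCH posC]; have /andP[cycC evC] := posC.
  have cardH : #|H| = #|C| + #|H :\: C|.
    by rewrite -(cardsID C H) (setIidPr sCH).
  have C_gt0 : 0 < #|C| by rewrite card_gt0; apply: cycle_neq0.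
  have [||ps [P [posps ncP disP covH [sumH oddH]]]] := IHn (H :\: C).
  - move: leH; rewrite cardH ltnS; apply: leq_trans.
    by rewrite -[X in X < _]add0n ltn_add2r.
  - by apply: even_setD => //; apply: cycle_even.
  exists (C :: ps), P; split=> //.
  - by move=> D; rewrite inE => /predU1P[->|/posps].
  - move=> e eH; case: (boolP (e \in C)) => eC; first by exists C; rewrite ?mem_head.
    have [|D DP eD] := covH e; first by rewrite inE eC.
    by exists D; rewrite // inE -orbA DP orbT.
  - split; first by rewrite big_cons -addnA sumH cardH.
    rewrite oddH -[in RHS](setID H C) (setIidPr sCH) setIUl cardsU.
    rewrite (_ : C :&: _ :&: _ = set0); last first.
      by apply/setP => e; rewrite !inE; case: (e \in C); rewrite ?andbF.
    by rewrite cards0 subn0 oddD (negPf evC).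
move=> /existsPn noC; have [P [partP cycP]] := cycle_partition evH.
have sPH C : C \in P -> C \subset H by apply: partitionS partP.
have ncP C : C \in P -> negative_cycle sigma C.
  move=> CP; rewrite /negative_cycle cycP //=.
  by have := noC C; rewrite sPH // /positive_cycle cycP //= negbK.
exists [::], P; split=> //.
- move=> C D CP DP CD.
  have disCD : C :&: D = set0.
    by apply/eqP; rewrite setI_eq0; have /and3P[_ /trivIsetP tr _] := partP; apply: tr.
  split=> //; rewrite leqNgt; apply/negP => gt1.
  have [F sF posF] := positive_cycle_of_two (ncP _ CP) (ncP _ DP) disCD gt1.
  by have := noC F; rewrite posF (subset_trans sF) // subUset !sPH.
- move=> e; rewrite -(cover_partition partP) => /bigcupP[C CP eC].
  by exists C; rewrite ?CP ?orbT.
- split; first by rewrite big_nil add0n (card_partition partP).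
  by apply: (partition_parity partP) => C CP; have /andP[] := ncP C CP.
Qed.

(* Each component of Q contains an even number of representatives, so two of them
   can be joined inside Q; removing the path preserves the parity condition. *)
Lemma barbell_pairing P (r : {set edge G} -> vertex G) Q :
  (forall C, C \in P -> negative_cycle sigma C /\ r C \in cov C) ->
  {in P &, forall C D, C != D -> C :&: D = set0 /\ #|cov C :&: cov D| <= 1} ->
  (forall v, divg (ind bool Q) v = \sum_(C in P) true *+ (r C == v))%R ->
  exists BB : seq {set edge G},
    [/\ forall F, F \in BB -> barbell sigma F,
        forall C, C \in P -> exists2 F : {set edge G}, F \in BB & C \subset F &
        \sum_(F <- BB) #|F| <= \sum_(C in P) #|C| + #|Q|].
Proof.
have [n] := ubnP #|P|; elim: n P Q => // n IHn P Q leP ncP disP divQ.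
case: (set_0Vmem P) => [->|[C1 C1P]].
  by exists [::]; split=> [F|C|]; rewrite ?inE ?big_nil.
have [C2 /andP[C2P C21] con] : exists2 C2, (C2 \in P) && (C2 != C1) &
    r C2 \in component Q (r C1).
  apply/exists_inP; apply: contraT; rewrite negb_exists_in => /forall_inP noC2.
  have := sum_divg_component Q (r C1); under eq_bigr do rewrite divQ.
  rewrite exchange_big /= (bigD1 C1) //= sum_mulrn_eq inE connect0 big1 // => C CP.
  by rewrite sum_mulrn_eq (negPf (noC2 _ CP)).
(* Two cycles that share a vertex may have the same representative; the path is then trivial. *)
have [p [pth pE sp]] : exists p, [/\ is_path (r C1) p, path_end (r C1) p = r C2
    & path_edges p \subset Q] by apply: connect_to_path; rewrite inE in con.
have [neg1 r1] := ncP _ C1P; have [neg2 r2] := ncP _ C2P.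
have [|dis12 cov12] := disP _ _ C1P C2P; first by rewrite eq_sym.
have [|F [barF sF leF]] := barbell_of_path neg1 neg2 dis12 cov12 pth r1.
  by rewrite pE.
have C2P1 : C2 \in P :\ C1 by rewrite !inE C21.
have subP C : C \in P :\ C1 :\ C2 -> C \in P by rewrite !inE => /and3P[].
have [||||BB [barBB covBB leBB]] := IHn (P :\ C1 :\ C2) (Q :\: path_edges p).
- by move: leP; rewrite (cardsD1 C1) C1P (cardsD1 C2) C2P1; lia.
- by move=> C /subP/ncP.
- by move=> C D /subP CP /subP DP; apply: disP.
- move=> v; apply: (GRing.addIr (divg (ind bool (path_edges p)) v)).
  rewrite -divgD (eq_divg (g := ind bool Q)); last first.
    move=> e; rewrite /ind in_setD; have := subsetP sp e.
    by case: (e \in path_edges p) => [->|_] //=; rewrite GRing.addr0.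
  rewrite divQ (big_setD1 C1) //= (big_setD1 C2) //= GRing.addrA GRing.addrC.
  congr (_ + _)%R; rewrite -odd_degree (odd_degree_path _ pth) pE ![v == _]eq_sym.
  by case: (_ == v); case: (_ == v).
exists (F :: BB); split.
- by move=> D; rewrite inE => /predU1P[->|/barBB].
- move=> C CP; case: (boolP (C \subset F)) => [sCF|nCF].
    by exists F; rewrite ?mem_head.
  have [|D DBB sD] := covBB C; last by exists D; rewrite // inE DBB orbT.
  rewrite !inE CP andbT; apply/andP; split; apply: contraNneq nCF => ->.
    by rewrite (subset_trans _ sF) ?subsetUr.
  by rewrite (subset_trans _ sF) ?subsetUl.
- rewrite big_cons (big_setD1 C1) //= (big_setD1 C2) //=.
  have : #|Q| = #|path_edges p| + #|Q :\: path_edges p|.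
    by rewrite -(cardsID (path_edges p) Q) (setIidPr sp).
  move: leF leBB; move: (\sum_(_ <- _) _) (\sum_(_ in _) _).
  move: #|F| #|C1| #|C2| #|Q| #|path_edges p| #|Q :\: path_edges p|; clear; lia.
Qed.

End SignedCovers.

Lemma cut_symdiff (G : multigraph) (S R : {set vertex G}) :
  cut ((S :\: R) :|: (R :\: S)) = symdiff (cut S) (cut R).
Proof.
apply/setP => e; rewrite in_symdiff !in_cut_cut !in_cutE !inE.
by case: (src e \in S); case: (src e \in R); case: (tgt e \in S); case: (tgt e \in R).
Qed.

Lemma two_edge_connected_connect (G : multigraph) (x y : vertex G) :
  two_edge_connected G -> connect (adj setT) x y.
Proof.
case/andP => /andP[_ /forall_inP con] _.
by move: (con x); rewrite inE => /(_ isT)/forall_inP; apply; rewrite inE.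
Qed.

(** * Minimal signatures *)

Section MinimalSignature.
Variables (G : multigraph) (N : {set edge G}).
Hypothesis G2ec : two_edge_connected G.
Hypothesis N_min : forall S : {set vertex G}, #|cut S :&: N| <= #|cut S :\: N|.
Implicit Types (S : {set vertex G}) (Q H : {set edge G}).

(* The bridges of G - N, in terms of cuts. *)
Definition positive_bridges : {set edge G} :=
  [set b | [exists S : {set vertex G}, cut S :\: N == [set b]]].

Definition positive_core : {set edge G} := ~: (N :|: positive_bridges).

Lemma positive_bridgeP b :
  reflect (exists S, cut S :\: N = [set b]) (b \in positive_bridges).
Proof. by rewrite inE; apply: (iffP existsP) => -[S /eqP cutS]; exists S. Qed.

(** Adding to a cut another one whose only edge outside [N] is a bridge [b] of the first removes [b]
    and changes nothing else outside [N]. Once no such bridge is left, a single core edge would be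
    the only edge outside [N], hence a bridge itself. *)
Lemma positive_core_bridgeless S : #|cut S :&: positive_core| != 1.
Proof.
apply/negP => /cards1P[e]; have [n] := ubnP #|cut S :&: positive_bridges :\: N|.
elim: n S => // n IHn S leS cutS.
have eA : e \in positive_core.
  by have := set11 e; rewrite -cutS inE => /andP[].
case: (set_0Vmem (cut S :&: positive_bridges :\: N)) => [noB|[b]].
  move: eA; rewrite !inE negb_or => /andP[_ /existsP[]]; exists S.
  rewrite -cutS; apply/eqP/setP => e'; have /setP/(_ e') := noB.
  rewrite /positive_core in_set0 !(in_setD, in_setI, in_setC, in_setU).
  by case: (e' \in N); case: (e' \in cut S); case: (e' \in positive_bridges).
rewrite in_setD in_setI => /and3P[bN bS bB]; have [R cutR] := positive_bridgeP _ bB.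
have inR e' : e' \notin N -> (e' \in cut R) = (e' == b).
  by move=> e'N; have /setP/(_ e') := cutR; rewrite in_setD e'N in_set1.
apply: (IHn ((S :\: R) :|: (R :\: S))).
  rewrite ltnS in leS; apply: leq_trans leS; apply: proper_card; apply/properP; split.
    apply/subsetP => e'; rewrite cut_symdiff !in_setD !in_setI in_symdiff.
    case: (boolP (e' \in N)) => //= e'N; rewrite inR //.
    by case: eqP => [->|_]; rewrite ?bS ?addbF.
  exists b; first by rewrite in_setD in_setI bN bS.
  by rewrite cut_symdiff in_setD in_setI in_symdiff inR // eqxx bS /= andbF.
rewrite -cutS cut_symdiff; apply/setP => e'; rewrite !in_setI in_symdiff.
rewrite /positive_core in_setC in_setU.
case: (boolP (e' \in N)) => [_|e'N]; first by rewrite /= !andbF.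
by rewrite inR //; case: eqP => [->|_]; rewrite ?bB ?addbF ?andbF.
Qed.

(* By minimality a bridge of G - N lies in a cut whose only other edge is in N. *)
Lemma even_contains_positive_bridges H :
  even_set H -> N \subset H -> positive_bridges \subset H.
Proof.
move=> evH sNH; apply/subsetP => b /positive_bridgeP[S cutS].
have := N_min S; have := bridgeless_cut S G2ec; rewrite -(cardsID N (cut S)) cutS cards1.
rewrite addn1 eqSS => c0 c1.
have /cards1P[m cutm] : #|cut S :&: N| == 1 by rewrite eqn_leq c1 lt0n.
have bS : (b \in cut S) && (b \notin N).
  by have := set11 b; rewrite -cutS in_setD andbC.
have mS : (m \in cut S) && (m \in N) by have := set11 m; rewrite -cutm in_setI.
have cutE : cut S = [set m; b] by rewrite -(setID (cut S) N) cutm cutS.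
apply/negPn/negP => bH; have := even_cut S evH.
rewrite (_ : H :&: cut S = [set m]) ?cards1 //.
apply/setP => e; rewrite in_setI cutE in_set1 in_set2.
case: (eqVneq e m) => [->|_]; first by rewrite (subsetP sNH) //; case/andP: mS.
by case: (eqVneq e b) => [->|_] /=; rewrite ?(negPf bH) ?andbF.
Qed.

(** The cut around a component of the graph without [N] lies in [N], so minimality makes it
    empty. *)
Lemma connect_positive x y : connect (adj (~: N)) x y.
Proof.
pose K := component (~: N) x.
have cutK : cut K = set0.
  have cutN : cut K \subset N.
    apply/subsetP => e; rewrite in_cut_cut in_cutE; apply: contraTT => eN.
    by rewrite (@component_end _ (~: N)) ?in_setC // addbb.
  apply/eqP; rewrite -cards_eq0 -leqn0; have := N_min K.
  rewrite (setIidPl cutN) (_ : cut K :\: N = set0) ?cards0 //.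
  by apply/eqP; rewrite setD_eq0.
have : connect (adj setT) x y by apply: two_edge_connected_connect.
suff closedK : closed (adj setT) K.
  by move/(closed_connect closedK); rewrite !inE connect0 => <-.
move=> a b /adjP[e _ ab].
have : e \notin cut K by rewrite cutK inE.
rewrite in_cut_cut in_cutE; have [[-> ->]|[-> ->]] := joins_endsP _ _ _ ab;
  by case: (a \in K); case: (b \in K).
Qed.

(** A join outside [N] with the same odd vertices as [N] completes [N] to an even set. Translation
    by an even subset of the core leaves [N] in place. *)
Lemma even_superset :
  exists H : {set edge G}, [/\ even_set H, N \subset H &
    2 * #|H :&: positive_core| <= #|positive_core|].
Proof.
have [Q sQ divQ] := join_exists connect_positive (sum_divgT (ind bool N)).
have [X [sXA evX leX]] := half_translate positive_core_bridgeless (symdiff N Q).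
exists (symdiff (symdiff N Q) X); split=> //.
  apply: even_symdiff => //; apply/even_setP => v.
  transitivity (divg (fun e => ind bool N e + ind bool Q e)%R v).
    by apply: eq_divg => e; rewrite /ind in_symdiff; case: (e \in N); case: (e \in Q).
  by rewrite divgD divQ; case: (divg _ v).
apply/subsetP => e eN; rewrite !in_symdiff eN.
have -> : (e \in Q) = false by apply: contraTF eN => /(subsetP sQ); rewrite inE.
have -> // : (e \in X) = false.
by apply: contraTF eN => /(subsetP sXA); rewrite !inE negb_or => /andP[].
Qed.

(** Adding an even set does not change which degrees are odd, so any join can be translated to one
    with at most half of all edges. *)
Lemma short_join (b : vertex G -> bool) : (\sum_v b v = 0)%R ->
  exists2 Q : {set edge G}, 2 * #|Q| <= #|edge G| & forall v, divg (ind bool Q) v = b v.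
Proof.
move=> sumb; have [Q _ divQ] :=
  join_exists (fun x y => two_edge_connected_connect x y G2ec) sumb.
have [|X [_ evX leX]] := @half_translate G setT _ Q.
  by move=> S; rewrite setIT; apply: bridgeless_cut.
exists (symdiff Q X); first by rewrite setIT cardsT in leX.
by move=> v; rewrite divg_symdiff.
Qed.

End MinimalSignature.

(** * Covers of the core and of the even set, and the final count *)

Lemma cover_positive_core (G : multigraph) (tau : signature G) :
  exists ds : seq {set edge G},
    [/\ forall C : {set edge G}, C \in ds -> positive_cycle tau C,
        forall e, e \in positive_core (neg_edges tau) ->
          exists2 C : {set edge G}, C \in ds & e \in C &
        3 * \sum_(C <- ds) #|C| <= 5 * #|positive_core (neg_edges tau)|].
Proof.
have [cs [sevcs covcs lecs]] :=
  even_cover_five_thirds (@positive_core_bridgeless G (neg_edges tau)).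
have [ds [cycds covds sumds]] := even_to_cycles sevcs.
exists ds; split=> [C /cycds[sC cycC]|e /covcs/covds //|]; last by rewrite sumds.
rewrite /positive_cycle cycC (_ : C :&: _ = set0) ?cards0 //.
apply/eqP; rewrite setI_eq0 disjoints_subset (subset_trans sC) //.
by rewrite setCS subsetUl.
Qed.

Lemma cover_even_set (G : multigraph) (tau : signature G) (H : {set edge G}) :
  two_edge_connected G -> even_set H -> ~~ odd #|H :&: neg_edges tau| ->
  exists ds : seq {set edge G},
    [/\ forall F, F \in ds -> signed_circuit tau F,
        forall e, e \in H -> exists2 F : {set edge G}, F \in ds & e \in F &
        2 * \sum_(F <- ds) #|F| <= 2 * #|H| + #|edge G|].
Proof.
move=> G2ec evH evenH.
have [ps [P [posps ncP disP covH [sumH oddP]]]] := signed_decomposition tau evH.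
have /set0Pn[v0 _] : [set: vertex G] != set0 by case/andP: G2ec => /andP[].
pose r (C : {set edge G}) := odflt v0 [pick v in cov C].
have rP C : C \in P -> r C \in cov C.
  move=> /ncP/andP[/cycle_cov_neq0/set0Pn[v vC] _]; rewrite /r.
  by case: pickP => [//|/(_ v)]; rewrite vC.
(* Summed over all vertices each cycle counts once, so the total is the parity of the size of [P],
   which is that of the number of negative edges in [H]. *)
have [|Q leQ divQ] := @short_join G G2ec (fun v => \sum_(C in P) true *+ (r C == v))%R.
  rewrite exchange_big /=.
  rewrite (eq_bigr (fun=> 1%R)) => [|C _].
    by rewrite sumr_const odd_natr oddP; apply: negPf.
  transitivity (\sum_(v in [set: vertex G]) true *+ (r C == v))%R.
    by apply: eq_bigl => v; rewrite inE.
  by rewrite sum_mulrn_eq inE.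
have [|BB [barBB covBB leBB]] := @barbell_pairing G tau P r Q _ disP divQ.
  by move=> C CP; split; [apply: ncP | apply: rP].
exists (ps ++ BB); split.
- by move=> F; rewrite mem_cat => /orP[/posps|/barBB]; [left | right].
- move=> e /covH[C /orP[Cps|CP] eC]; first by exists C; rewrite // mem_cat Cps.
  have [F FBB sCF] := covBB C CP.
  by exists F; rewrite ?mem_cat ?FBB ?orbT // (subsetP sCF).
- rewrite big_cat /=; move: sumH leBB leQ.
  move: (\sum_(_ <- ps) _) (\sum_(_ <- BB) _) (\sum_(_ in P) _) #|Q| #|H| #|edge G|.
  by clear; lia.
Qed.

Local Open Scope ring_scope.

Theorem theorem3p3 (G : multigraph) (sigma : signature G)
  (G2ec : two_edge_connected G)
  (has_edge : (0 < #|edge G|)%N)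
  (even_neg : ~~ odd (negativeness sigma)) :
  exists CC : seq {set edge G},
    signed_circuit_cover sigma CC /\
    (cover_length CC)%:R < 8 / 3 * #|edge G|%:R :> rat.
Proof.
have [[tau eq_st negE] neg_min] := negativenessP sigma.
suff [CC [circCC covCC leCC]] : exists CC : seq {set edge G},
    [/\ forall F, F \in CC -> signed_circuit tau F,
        forall e, exists2 F : {set edge G}, F \in CC & e \in F &
        (3 * cover_length CC < 8 * #|edge G|)%N].
  exists CC; split.
    by split=> // F /circCC; apply: signed_circuit_switch.
  rewrite mulrAC ltr_pdivlMr // -!natrM ltr_nat mulnC; exact: leCC.
pose N := neg_edges tau; pose A := positive_core N.
have N_min (S : {set vertex G}) : (#|cut S :&: N| <= #|cut S :\: N|)%N.
  by apply: (minimal_signature_cut S eq_st) => rho eq_sr; rewrite -negE; apply: neg_min.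
have [ds [posds covds leds]] := cover_positive_core tau; rewrite -/N -/A in covds leds.
have cardE : #|edge G| = (#|A| + #|N :|: positive_bridges N|)%N.
  by rewrite -(cardsC A) {2}/A /positive_core setCK.
(* If this set is empty, the core is the whole graph and its cover suffices: 5/3 is strictly better
   than 8/3 because there is an edge. *)
case: (set_0Vmem (N :|: positive_bridges N)) => [NB0|[e0 e0NB]].
  exists ds; split.
  - by move=> F /posds; left.
  - by move=> e; apply: covds; rewrite /A /positive_core NB0 setC0 inE.
  - move: leds cardE has_edge; rewrite NB0 cards0 /cover_length; lia.
have [H [evH sNH leH]] := even_superset G2ec N_min.
have sBH := even_contains_positive_bridges G2ec N_min evH sNH.
have [|hs [circhs covhs lehs]] := @cover_even_set G tau H G2ec evH.
  by rewrite (setIidPr sNH) -negE.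
exists (ds ++ hs); split.
- by move=> F; rewrite mem_cat => /orP[/posds|/circhs //]; left.
- move=> e; case: (boolP (e \in A)) => [/covds|]; last first.
    rewrite inE negbK => eNB; have [|F Fhs eF] := covhs e.
      by move: eNB; rewrite in_setU => /orP[/(subsetP sNH)|/(subsetP sBH)].
    by exists F; rewrite // mem_cat Fhs orbT.
  by case=> F Fds eF; exists F; rewrite // mem_cat Fds.
- rewrite /cover_length big_cat /=.
  have NB_gt0 : (0 < #|N :|: positive_bridges N|)%N by apply/card_gt0P; exists e0.
  have cardH : #|H| = (#|H :&: A| + #|N :|: positive_bridges N|)%N.
    rewrite -(cardsID A H) (_ : H :\: A = N :|: positive_bridges N) //.
    rewrite /A /positive_core setDE setCK; apply/setIidPr.
    by rewrite subUset sNH.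
  (* Six times the length is at most 16 times the size of [A] plus 9 times that of
     [N :|: positive_bridges N]; as the latter is positive, 9 < 16 gives strictness. *)
  move: leds lehs leH cardE NB_gt0 cardH; rewrite -/A.
  move: (\sum_(_ <- ds) _)%N (\sum_(_ <- hs) _)%N #|A| #|H| #|H :&: A|.
  move: #|N :|: _| #|edge G|; clear; lia.
Qed.
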